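(* Let $M$ be a connected manifold with contractible universal cover, and let $M_1\to M$, $M_2\to M$ be integrally equivalent covers of degree $d$. If $M_1'\to M_1$ and $M_2'\to M_2$ are corresponding abelian covers of degree $d'$ with $\gcd(d,d')=1$, then $M_1'\to M$ and $M_2'\to M$ have the same normal (regular) closure over $M$.
   Context: A triple of groups $(G,G_1,G_2)$ with $[G:G_i]<\infty$ is an integral Gassmann triple if $\mathbb{Z}[G/G_1]\simeq\mathbb{Z}[G/G_2]$ as $\mathbb{Z}G$-modules ($G$ acting on cosets by left multiplication). Covers $M_1,M_2\to M$ are integrally equivalent if their normal closure $N\to M$ is a regular $G$-covering, $M_i$ is the intermediate cover corresponding to a subgroup $G_i\le G$, and $(G,G_1,G_2)$ is an integral Gassmann triple. Then with $\Gamma=\pi_1(M)$, $\Gamma_i=\pi_1(M_i)$, $(\Gamma,\Gamma_1,\Gamma_2)$ is an integral Gassmann triple with $[\Gamma:\Gamma_i]=d$. Isomorphism in homology: for $i=1,2$ let $\Delta_i:\mathbb{Z}\to\mathbb{Z}[\Gamma/\Gamma_i]$, $n\mapsto n\sum_{x\in\Gamma/\Gamma_i}x$, and $\varepsilon_i:\mathbb{Z}[\Gamma/\Gamma_i]\to\mathbb{Z}$ the augmentation. Choose a $\mathbb{Z}\Gamma$-module isomorphism $\psi:\mathbb{Z}[\Gamma/\Gamma_1]\to\mathbb{Z}[\Gamma/\Gamma_2]$ with $\psi\circ\Delta_1=\Delta_2$ and $\varepsilon_2\circ\psi=\varepsilon_1$ (replacing $\psi$ by $-\psi$ if needed). Let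 $\varphi:H_1(M_1)=H_1(\Gamma_1)\to H_1(\Gamma_2)=H_1(M_2)$ be the composite of Shapiro's isomorphism $H_1(\Gamma_1,\mathbb{Z})\simeq H_1(\Gamma,\mathbb{Z}[\Gamma/\Gamma_1])$, the map induced by $\psi$, and Shapiro's isomorphism $H_1(\Gamma,\mathbb{Z}[\Gamma/\Gamma_2])\simeq H_1(\Gamma_2,\mathbb{Z})$. Covers $M_i'\to M_i$ correspond if there are finite index subgroups $U_i\subset H_1(M_i)$ with $\varphi(U_1)=U_2$ and $\pi_1(M_i')$ equal to the preimage of $U_i$ under $\pi_1(M_i)\to H_1(M_i)$; their degree is $[H_1(M_i):U_i]$. *)

(* Defs.v *)
From HB Require Import structures.
From mathcomp Require Import all_boot all_order all_algebra.
From mathcomp Require Import generic_quotient ring_quotient finmap.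
From mathcomp Require Import all_classical all_reals all_analysis homotopy.
From mathcomp Require Import lra.

Set Implicit Arguments.
Unset Strict Implicit.
Unset Printing Implicit Defensive.

Import Order.TTheory GRing.Theory Num.Theory.
Import numFieldNormedType.Exports numFieldTopology.Exports.

Local Open Scope classical_set_scope.
Local Open Scope ring_scope.
Local Open Scope quotient_scope.

Section FinSuppFunctions.
Variables (K : choiceType) (A : zmodType).

Definition finsupp_pred : {pred K -> A} :=
  fun f => `[< finite_set [set k | f k != 0] >].

Lemma finsupp_zmod_closed : zmod_closed finsupp_pred.
Proof.
split=> [|f g /asboolP hf /asboolP hg]; apply/asboolP.
  rewrite (_ : [set _ | _] = set0); first exact: finite_set0.
  by apply/seteqP; split=> // k /=; rewrite eqxx.
apply: (@sub_finite_set _ _ ([set k | f k != 0] `|` [set k | g k != 0])).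
  move=> k /=; have [fk0|] := eqVneq (f k) 0; last by left.
  have [gk0|] := eqVneq (g k) 0; last by right.
  by rewrite [X in X != 0](_ : _ = f k - g k) // fk0 gk0 subrr eqxx.
by rewrite finite_setU.
Qed.

HB.instance Definition _ :=
  GRing.isZmodClosed.Build (K -> A) finsupp_pred finsupp_zmod_closed.

Definition finsupp : Type := {f : K -> A | f \in finsupp_pred}.

HB.instance Definition _ := [isSub of finsupp for @sval _ _].
HB.instance Definition _ := [Choice of finsupp by <:].
HB.instance Definition _ := [SubChoice_isSubZmodule of finsupp by <:].

Definition fcoef (c : finsupp) : K -> A := \val c.
Coercion fcoef : finsupp >-> Funclass.

Lemma single_subproof (k : K) (a : A) :
  (fun k' => if k' == k then a else 0) \in finsupp_pred.
Proof.
apply/asboolP/(@sub_finite_set _ _ [set k]); last exact: finite_set1.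
by move=> k' /=; case: (k' =P k) => // _; rewrite eqxx.
Qed.

Definition single (k : K) (a : A) : finsupp :=
  Sub (fun k' => if k' == k then a else 0) (single_subproof k a).

Lemma finsuppP (c c' : finsupp) : c =1 c' <-> c = c'.
Proof. by split=> [h|-> //]; apply/val_inj/funext. Qed.

Lemma fcoef_finite (c : finsupp) : finite_set [set k | c k != 0].
Proof. by apply/asboolP; exact: (valP c). Qed.

Lemma fcoef0 k : (0 : finsupp) k = 0. Proof. by []. Qed.
Lemma fcoefD (c c' : finsupp) k : (c + c' : finsupp) k = c k + c' k. Proof. by []. Qed.
Lemma fcoefN (c : finsupp) k : (- c : finsupp) k = - c k. Proof. by []. Qed.
Lemma fcoefB (c c' : finsupp) k : (c - c' : finsupp) k = c k - c' k. Proof. by []. Qed.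

Lemma single_is_zmod (k : K) : zmod_morphism (single k).
Proof.
move=> a b; apply/finsuppP => k'; rewrite fcoefB /fcoef /=.
by case: (k' =P k); rewrite ?subrr.
Qed.

HB.instance Definition _ k := GRing.isZmodMorphism.Build A finsupp (single k)
  (@single_is_zmod k).

Lemma fsumE (B : zmodType) (F : K -> A -> B) (c : finsupp) (X : {fset K}) :
  (forall k, F k 0 = 0) -> [set k | c k != 0] `<=` [set` X] ->
  \sum_(k \in [set: K]) F k (c k) = \sum_(k <- X) F k (c k).
Proof.
move=> F0 hX; apply: fsbigTE => k /negP kX.
by have [->|/hX] := eqVneq (c k) 0; [rewrite F0|move/kX].
Qed.

Lemma fsum_additive (B : zmodType) (F : K -> {additive A -> B})
    (c c' : finsupp) :
  \sum_(k \in [set: K]) F k ((c - c' : finsupp) k) =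
  \sum_(k \in [set: K]) F k (c k) - \sum_(k \in [set: K]) F k (c' k).
Proof.
have fX : finite_set ([set k | c k != 0] `|` [set k | c' k != 0]).
  by rewrite finite_setU; split; exact: fcoef_finite.
have /finite_fsetP [X hX] := fX.
have F0 k : F k 0 = 0 by rewrite raddf0.
rewrite !(@fsumE _ (fun k => F k) _ X) //.
- by rewrite -sumrB; apply: eq_bigr => k _; rewrite -raddfB.
- by rewrite -hX => k h; right.
- by rewrite -hX => k h; left.
rewrite -hX => k /=; rewrite fcoefB.
have [->|] := eqVneq (c k) 0; last by left.
have [->|] := eqVneq (c' k) 0; last by right.
by rewrite subrr eqxx.
Qed.

Lemma fsum_single (B : zmodType) (F : K -> {additive A -> B}) k a :
  \sum_(i \in [set: K]) F i (single k a i) = F k a.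
Proof.
rewrite (@fsumE _ (fun k => F k) _ [fset k]%fset); first 1 last.
- by move=> i; rewrite raddf0.
- by move=> i; rewrite /fcoef /=; case: (i =P k) => [-> _|_]; rewrite ?eqxx // inE.
by rewrite big_seq_fset1 /fcoef /= eqxx.
Qed.

Lemma finsupp_sumE (c : finsupp) :
  c = \sum_(k \in [set: K]) single k (c k).
Proof.
have /finite_fsetP [X hX] := fcoef_finite c.
rewrite (@fsumE _ single _ X) ?hX // => [|k]; last by rewrite raddf0.
apply/finsuppP => k.
rewrite (big_morph (fun c0 : finsupp => c0 k)
  (fun a b => fcoefD a b k) (fcoef0 k)) /fcoef /=.
have [kX|kX] := boolP (k \in X).
  rewrite (big_fsetD1 k) //= eqxx big_seq big1 ?addr0 // => i.
  by rewrite !inE eq_sym => /andP[/negPf ->].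
rewrite big_seq big1 => [|i iX].
  apply/eqP/negPn/negP => ck; move/negP: kX; apply.
  by have : [set k | c k != 0] k by []; rewrite hX.
by case: (k =P i) => // ki; rewrite ki iX in kX.
Qed.

Lemma eq_on_single (B : zmodType) (f g : {additive finsupp -> B}) :
  (forall k a, f (single k a) = g (single k a)) -> f =1 g.
Proof.
move=> fg c; have /finite_fsetP [X hX] := fcoef_finite c.
rewrite (finsupp_sumE c) (@fsumE _ single _ X) ?hX // => [|k].
  by rewrite !raddf_sum; apply: eq_bigr => k _; exact: fg.
by rewrite raddf0.
Qed.

End FinSuppFunctions.

(* A left ZG-module, presented as an abelian group with an additive action. *)
Record gmodule (G : groupType) := GModule {
  gmod_sort :> zmodType;
  gact : G -> {additive gmod_sort -> gmod_sort};
  gact1 : forall a, gact 1%g a = a;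
  gactM : forall g h a, gact (g * h)%g a = gact g (gact h a)
}.

Arguments gact {G A} g : rename.

Record gmodHom (G : groupType) (A B : gmodule G) := GModHom {
  gmodHom_fun :> {additive A -> B};
  gmodHom_act : forall g a, gmodHom_fun (gact g a) = gact g (gmodHom_fun a)
}.

Definition trivial_gmodule (G : groupType) (A : zmodType) : gmodule G :=
  @GModule G A (fun=> idfun) (fun=> erefl) (fun _ _ _ => erefl).

Section Cosets.
Variable G : groupType.
Implicit Types (g h : G) (H : set G).

Definition is_subgroup H :=
  [/\ H 1%g, forall g h, H g -> H h -> H (g * h)%g & forall g, H g -> H g^-1%g].

Definition lcoset H g : set G := [set (g * h)%g | h in H].
Definition lcosets H : set (set G) := range (lcoset H).

Definition coset_type H : choiceType := set_type (lcosets H).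

Definition to_coset H g : coset_type H := SigSub (mem_set (imageT (lcoset H) g)).

Lemma coset_act_subproof H g (x : coset_type H) :
  [set (g * k)%g | k in \val x] \in lcosets H.
Proof.
have /set_mem [h _ <-] := valP x; apply/mem_set; exists (g * h)%g => //.
apply/seteqP; split=> k /=.
  by move=> [l Hl <-]; exists (h * l)%g; [exists l|rewrite mulgA].
by move=> [_ [l Hl <-] <-]; exists l => //; rewrite mulgA.
Qed.

Definition coset_act H g (x : coset_type H) : coset_type H :=
  SigSub (coset_act_subproof g x).

Lemma coset_act1 H x : @coset_act H 1%g x = x.
Proof.
apply/val_inj/seteqP; split=> k /= => [[l xl <-]|xk]; first by rewrite mul1g.
by exists k => //; rewrite mul1g.
Qed.

Lemma coset_actM H g h x :
  @coset_act H (g * h)%g x = coset_act g (coset_act h x).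
Proof.
apply/val_inj/seteqP; split=> k /= => [[l xl <-]|[_ [l xl <-] <-]].
  by exists (h * l)%g; [exists l|rewrite mulgA].
by exists l => //; rewrite mulgA.
Qed.

Lemma coset_act_to H g h :
  coset_act g (to_coset H h) = to_coset H (g * h)%g.
Proof.
apply/val_inj/seteqP; split=> k /= => [[_ [l Hl <-] <-]|[l Hl <-]].
  by exists l => //; rewrite mulgA.
by exists (h * l)%g; [exists l|rewrite mulgA].
Qed.

Lemma to_coset_eq1 H h : is_subgroup H -> H h -> to_coset H h = to_coset H 1%g.
Proof.
move=> [H1 HM HV] Hh; apply/val_inj/seteqP; split=> k /= [l Hl <-].
  by exists (h * l)%g; [exact: HM|rewrite mul1g].
by exists (h^-1 * l)%g; [exact/HM/Hl/HV|rewrite mulgA mulgV].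
Qed.

Section PermutationModule.
Variable H : set G.

Definition perm_act g (c : finsupp (coset_type H) int) :
    finsupp (coset_type H) int :=
  \sum_(x \in [set: coset_type H]) single (coset_act g x) (c x).

Lemma perm_act_is_zmod g : zmod_morphism (perm_act g).
Proof.
move=> c c'.
exact: (fsum_additive (fun x => single (coset_act g x) : {additive _ -> _})).
Qed.

HB.instance Definition _ g := GRing.isZmodMorphism.Build _ _
  (perm_act g) (perm_act_is_zmod g).

Lemma perm_act_single g x n :
  perm_act g (single x n) = single (coset_act g x) n.
Proof.
exact: (fsum_single (fun x => single (coset_act g x) : {additive _ -> _})).
Qed.

Lemma perm_act1 c : perm_act 1%g c = c.
Proof.
rewrite [RHS]finsupp_sumE; apply: eq_fsbigr => x _.
by rewrite coset_act1.
Qed.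

Lemma perm_actM g h c : perm_act (g * h)%g c = perm_act g (perm_act h c).
Proof.
move: c; apply: (@eq_on_single _ _ _ (perm_act (g * h)%g)
  (perm_act g \o perm_act h : {additive _ -> _})) => x n /=.
by rewrite !perm_act_single coset_actM.
Qed.

Definition perm_gmodule : gmodule G :=
  @GModule G (finsupp (coset_type H) int) perm_act perm_act1 perm_actM.

(* Delta : n |-> n * (sum of all cosets); the sum is meaningful when G/H is
   finite (it is 0 by convention otherwise). *)
Definition coset_diag (n : int) : perm_gmodule :=
  \sum_(x \in [set: coset_type H]) (single x n : perm_gmodule).

Definition augmentation (c : perm_gmodule) : int :=
  \sum_(x \in [set: coset_type H]) (c : finsupp _ _) x.

End PermutationModule.

Definition integral_gassmann_triple (H1 H2 : set G) : Prop :=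
  [/\ is_subgroup H1, is_subgroup H2,
      finite_set (lcosets H1), finite_set (lcosets H2) &
      exists psi : gmodHom (perm_gmodule H1) (perm_gmodule H2), bijective psi].

End Cosets.

Section GroupHomology.
Variables (G : groupType) (A : gmodule G).

(* Degree <= 2 part of the inhomogeneous bar complex C_n(G; A), whose elements
   are the finite sums of symbols a [g_1 | ... | g_n]; the right action needed
   to form A (x)_G - is a.g := g^-1 a. *)
Definition bar_d1 (c : finsupp G A) : A :=
  \sum_(g \in [set: G]) (gact g^-1%g (c g) - c g).

Definition bar_d2 (c : finsupp (G * G)%type A) : finsupp G A :=
  \sum_(g \in [set: G * G])
    (single g.2 (gact g.1^-1%g (c g)) - single (g.1 * g.2)%g (c g)
     + single g.1 (c g)).

Lemma bar_d1_is_zmod : zmod_morphism bar_d1.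
Proof.
move=> c c'.
pose F (g : G) : {additive A -> A} := (gact g^-1%g \- idfun).
exact: (fsum_additive F).
Qed.

HB.instance Definition _ := GRing.isZmodMorphism.Build _ _
  bar_d1 bar_d1_is_zmod.

Lemma bar_d1_single g a : bar_d1 (single g a) = gact g^-1%g a - a.
Proof.
pose F (g : G) : {additive A -> A} := (gact g^-1%g \- idfun).
exact: (fsum_single F).
Qed.

Lemma bar_d2_is_zmod : zmod_morphism bar_d2.
Proof.
move=> c c'.
pose F (g : G * G) : {additive A -> finsupp G A} :=
  ((single g.2 \o gact g.1^-1%g) \- single (g.1 * g.2)%g) \+ single g.1.
exact: (fsum_additive F).
Qed.

HB.instance Definition _ := GRing.isZmodMorphism.Build _ _
  bar_d2 bar_d2_is_zmod.

Lemma bar_d2_single (g : G * G) a :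
  bar_d2 (single g a) =
  single g.2 (gact g.1^-1%g a) - single (g.1 * g.2)%g a + single g.1 a.
Proof.
pose F (g : G * G) : {additive A -> finsupp G A} :=
  ((single g.2 \o gact g.1^-1%g) \- single (g.1 * g.2)%g) \+ single g.1.
exact: (fsum_single F).
Qed.

Definition bar_cycle_pred : {pred finsupp G A} := fun c => bar_d1 c == 0.

Lemma bar_cycle_zmod_closed : zmod_closed bar_cycle_pred.
Proof.
split=> [|c c' /eqP hc /eqP hc']; apply/eqP; first exact: raddf0.
by rewrite bar_d1_is_zmod hc hc' subrr.
Qed.

HB.instance Definition _ := GRing.isZmodClosed.Build (finsupp G A)
  bar_cycle_pred bar_cycle_zmod_closed.

Definition bar_cycle : Type := {c : finsupp G A | c \in bar_cycle_pred}.

HB.instance Definition _ := [isSub of bar_cycle for @sval _ _].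
HB.instance Definition _ := [Choice of bar_cycle by <:].
HB.instance Definition _ := [SubChoice_isSubZmodule of bar_cycle by <:].

Definition bar_boundary_pred : {pred bar_cycle} :=
  fun z => `[< exists c, bar_d2 c = \val z >].

Lemma bar_boundary_zmod_closed : zmod_closed bar_boundary_pred.
Proof.
split=> [|z z' /asboolP [c hc] /asboolP [c' hc']]; apply/asboolP.
  by exists 0; rewrite !raddf0.
by exists (c - c'); rewrite bar_d2_is_zmod hc hc' -raddfB.
Qed.

HB.instance Definition _ := GRing.isZmodClosed.Build bar_cycle
  bar_boundary_pred bar_boundary_zmod_closed.

Definition H1 : zmodType := Quotient.quot bar_boundary_pred.
Definition H1_class (z : bar_cycle) : H1 := \pi z.

Lemma H1_class_eq z z' :
  H1_class z = H1_class z' <-> exists c, bar_d2 c = \val z - \val z'.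
Proof.
split=> [/eqP|[c hc]]; last apply/eqP.
  by rewrite /H1_class -Quotient.idealrBE => /asboolP [c hc]; exists c; rewrite hc raddfB.
by rewrite /H1_class -Quotient.idealrBE; apply/asboolP; exists c; rewrite hc.
Qed.

End GroupHomology.

Notation H1Z G := (H1 (trivial_gmodule G int)).

(* A morphism of coefficient pairs (G, A) -> (G', A'), and the map it induces
   on first homology, a [g] |-> al(a) [f(g)]. *)
Record coefHom (G G' : groupType) (A : gmodule G) (A' : gmodule G') := CoefHom {
  coef_grp : {multiplicative G -> G'};
  coef_mod : {additive A -> A'};
  coef_compat : forall g a,
    coef_mod (gact g a) = gact (coef_grp g) (coef_mod a)
}.

Section InducedMap.
Variables (G G' : groupType) (A : gmodule G) (A' : gmodule G').
Variable f : coefHom A A'.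

Lemma coef_grpV g : coef_grp f g^-1%g = (coef_grp f g)^-1%g.
Proof.
have f1 : coef_grp f 1%g = 1%g.
  by apply: (mulgI (coef_grp f 1%g)); rewrite -gmulfM !mulg1.
by apply: (mulgI (coef_grp f g)); rewrite -gmulfM !mulgV.
Qed.

Definition bar_map1 (c : finsupp G A) : finsupp G' A' :=
  \sum_(g \in [set: G]) single (coef_grp f g) (coef_mod f (c g)).

Lemma bar_map1_is_zmod : zmod_morphism bar_map1.
Proof.
move=> c c'; pose F g : {additive A -> finsupp G' A'} :=
  single (coef_grp f g) \o coef_mod f.
exact: (fsum_additive F).
Qed.

HB.instance Definition _ := GRing.isZmodMorphism.Build _ _
  bar_map1 bar_map1_is_zmod.

Lemma bar_map1_single g a :
  bar_map1 (single g a) = single (coef_grp f g) (coef_mod f a).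
Proof.
pose F g : {additive A -> finsupp G' A'} :=
  single (coef_grp f g) \o coef_mod f.
exact: (fsum_single F).
Qed.

Lemma bar_map1_cycle (z : bar_cycle A) :
  bar_map1 (\val z) \in @bar_cycle_pred _ A'.
Proof.
apply/eqP; pose D := (@bar_d1 _ A' \o bar_map1 : {additive _ -> _}).
pose D' := (coef_mod f \o @bar_d1 _ A : {additive _ -> _}).
have DD' : D =1 D'.
  apply: eq_on_single => g a /=.
  by rewrite bar_map1_single !bar_d1_single raddfB coef_compat coef_grpV.
by rewrite -[LHS]/(D (\val z)) DD' /= (eqP (valP z)) raddf0.
Qed.

Definition H1_map (z : H1 A) : H1 A' :=
  H1_class (Sub (bar_map1 (\val (repr z))) (bar_map1_cycle (repr z))).

Definition bar_map2 (c : finsupp (G * G)%type A) : finsupp (G' * G')%type A' :=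
  \sum_(g \in [set: G * G])
    single (coef_grp f g.1, coef_grp f g.2) (coef_mod f (c g)).

Lemma bar_map2_is_zmod : zmod_morphism bar_map2.
Proof.
move=> c c'; pose F (g : G * G) : {additive A -> finsupp (G' * G')%type A'} :=
  single (coef_grp f g.1, coef_grp f g.2) \o coef_mod f.
exact: (fsum_additive F).
Qed.

HB.instance Definition _ := GRing.isZmodMorphism.Build _ _
  bar_map2 bar_map2_is_zmod.

Lemma bar_map1_d2 c : bar_map1 (bar_d2 c) = bar_d2 (bar_map2 c).
Proof.
move: c; apply: (@eq_on_single _ _ _
  (bar_map1 \o @bar_d2 _ A : {additive _ -> _})
  (@bar_d2 _ A' \o bar_map2 : {additive _ -> _})) => g a /=.
have -> : bar_map2 (single g a) =
    single (coef_grp f g.1, coef_grp f g.2) (coef_mod f a).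
  pose F (g : G * G) : {additive A -> finsupp (G' * G')%type A'} :=
    single (coef_grp f g.1, coef_grp f g.2) \o coef_mod f.
  exact: (fsum_single F).
have mD : {morph bar_map1 : x y / x + y} := raddfD _.
rewrite !bar_d2_single mD bar_map1_is_zmod !bar_map1_single /=.
by rewrite coef_compat coef_grpV gmulfM.
Qed.

Lemma H1_mapE z :
  H1_map (H1_class z) = H1_class (Sub (bar_map1 (\val z)) (bar_map1_cycle z)).
Proof.
have /H1_class_eq [c hc] : H1_class (repr (H1_class z)) = H1_class z.
  exact: reprK.
apply/H1_class_eq; exists (bar_map2 c).
by rewrite -bar_map1_d2 hc bar_map1_is_zmod.
Qed.

End InducedMap.

Section Shapiro.
Variables (G' G : groupType) (f : {multiplicative G' -> G}).

Lemma range_subgroup : is_subgroup (range f).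
Proof.
have f1 : f 1%g = 1%g by apply: (mulgI (f 1%g)); rewrite -gmulfM !mulg1.
split=> [|_ _ [g _ <-] [h _ <-]|_ [g _ <-]]; first by exists 1%g.
  by exists (g * h)%g => //; rewrite gmulfM.
by exists g^-1%g => //; apply: (mulgI (f g)); rewrite -gmulfM !mulgV.
Qed.

Lemma shapiro_compat g (n : int) :
  single (to_coset (range f) 1%g) (@gact _ (trivial_gmodule G' int) g n) =
  @gact _ (perm_gmodule (range f)) (f g) (single (to_coset (range f) 1%g) n).
Proof.
rewrite [RHS]perm_act_single coset_act_to mulg1.
congr single; apply/esym/to_coset_eq1; [exact: range_subgroup|by exists g].
Qed.

(* The map H_1(G', Z) -> H_1(G, Z[G/f(G')]) induced by f and by
   1 |-> the trivial coset; it is Shapiro's isomorphism when f is injective. *)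
Definition shapiro_coef :
    coefHom (trivial_gmodule G' int) (perm_gmodule (range f)) :=
  @CoefHom G' G (trivial_gmodule G' int) (perm_gmodule (range f)) f
    (single (to_coset (range f) 1%g)) shapiro_compat.

Definition shapiro : H1Z G' -> H1 (perm_gmodule (range f))
  := H1_map shapiro_coef.

End Shapiro.

Definition gmodHom_coef (G : groupType) (A B : gmodule G) (psi : gmodHom A B) :
  coefHom A B := @CoefHom G G A B idfun psi (@gmodHom_act G A B psi).

Section Abelianization.
Variable G : groupType.

Lemma ab_class_subproof (g : G) :
  (single g 1 : finsupp G (trivial_gmodule G int)) \in
  @bar_cycle_pred _ (trivial_gmodule G int).
Proof. by apply/eqP; rewrite bar_d1_single subrr. Qed.

(* The canonical map G -> H_1(G, Z), g |-> class of [g]. *)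
Definition ab_class (g : G) : H1Z G :=
  @H1_class G (trivial_gmodule G int)
    (exist (fun c => c \in @bar_cycle_pred G (trivial_gmodule G int))
       (single g 1) (ab_class_subproof g)).

End Abelianization.

Section UnitInterval.
Variable R : realType.

Definition unit_itv : set R := `[0, 1]%classic.

Definition I01 : Type := set_type unit_itv.

HB.instance Definition _ := Topological.copy I01 (set_type unit_itv).

Lemma I01_0 : (0 : R) \in unit_itv.
Proof. by apply/mem_set; rewrite /unit_itv /= in_itv /= lexx ler01. Qed.

Lemma I01_1 : (1 : R) \in unit_itv.
Proof. by apply/mem_set; rewrite /unit_itv /= in_itv /= lexx ler01. Qed.

Lemma I01_01 : (SigSub I01_0 : I01) != SigSub I01_1.
Proof. by apply/eqP => /(congr1 val)/eqP /=; rewrite eq_sym oner_eq0. Qed.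

HB.instance Definition _ := isBiPointed.Build I01 I01_01.

Definition I01val (t : I01) : R := \val t.

Lemma clamp_subproof (t : R) :
  Num.max 0 (Num.min 1 t) \in unit_itv.
Proof.
apply/mem_set; rewrite /unit_itv /= in_itv /= le_max lexx /=.
by rewrite ge_max ler01 ge_min lexx.
Qed.

Definition clamp (t : R) : I01 := SigSub (clamp_subproof t).

Lemma I01val_itv (t : I01) : 0 <= I01val t <= 1.
Proof. by have /set_mem := valP t; rewrite /unit_itv /= in_itv. Qed.

Lemma I01valK : cancel I01val clamp.
Proof.
move=> t; apply/val_inj => /=; have /andP[t0 t1] := I01val_itv t.
by rewrite min_r // max_r.
Qed.

Lemma clampK (t : R) : 0 <= t <= 1 -> I01val (clamp t) = t.
Proof. by move=> /andP[t0 t1]; rewrite /I01val /= min_r // max_r. Qed.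

Lemma clamp0 : clamp 0 = zero.
Proof. by apply/val_inj; rewrite /= min_r ?ler01 // max_r. Qed.

Lemma clamp1 : clamp 1 = one.
Proof. by apply/val_inj; rewrite /= min_r // max_r ?ler01. Qed.

Lemma clamp_le0 t : t <= 0 -> clamp t = zero.
Proof.
move=> t0; apply/val_inj; rewrite /= min_r ?(le_trans t0) ?ler01 //.
by rewrite max_l.
Qed.

Lemma clamp_ge1 t : 1 <= t -> clamp t = one.
Proof. by move=> t1; apply/val_inj; rewrite /= min_l // max_r ?ler01. Qed.

Lemma I01val_continuous : continuous I01val.
Proof. exact: initial_continuous. Qed.

Section ContinuousReal.
Variable T : topologicalType.
Implicit Types f g : T -> R.

Lemma continuous_add f g :
  continuous f -> continuous g -> continuous (fun t => f t + g t).
Proof. by move=> cf cg t; apply: cvgD; [exact: cf|exact: cg]. Qed.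

Lemma continuous_sub f g :
  continuous f -> continuous g -> continuous (fun t => f t - g t).
Proof. by move=> cf cg t; apply: cvgB; [exact: cf|exact: cg]. Qed.

Lemma continuous_mul f g :
  continuous f -> continuous g -> continuous (fun t => f t * g t).
Proof. by move=> cf cg t; apply: cvgM; [exact: cf|exact: cg]. Qed.

Lemma continuous_min f g :
  continuous f -> continuous g -> continuous (fun t => Num.min (f t) (g t)).
Proof.
move=> cf cg; rewrite (_ : (fun _ => _) =
  fun t => (f t + g t - `|f t - g t|) / 2); last first.
  by apply/funext => t; rewrite minr_absE.
apply: continuous_mul; last exact: cst_continuous.
apply: continuous_sub; first exact: continuous_add.
by move=> t; apply: cvg_norm; exact: (continuous_sub cf cg).
Qed.

Lemma continuous_max f g :
  continuous f -> continuous g -> continuous (fun t => Num.max (f t) (g t)).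
Proof.
move=> cf cg; rewrite (_ : (fun _ => _) =
  fun t => (f t + g t + `|f t - g t|) / 2); last first.
  by apply/funext => t; rewrite maxr_absE.
apply: continuous_mul; last exact: cst_continuous.
apply: continuous_add; first exact: continuous_add.
by move=> t; apply: cvg_norm; exact: (continuous_sub cf cg).
Qed.

End ContinuousReal.

Lemma clamp_continuous : continuous clamp.
Proof.
apply: (@continuous_comp_initial I01 R R (@set_val _ unit_itv) clamp).
apply: continuous_max; first exact: cst_continuous.
by apply: continuous_min; [exact: cst_continuous|move=> t; exact: cvg_id].
Qed.

End UnitInterval.

Section Pasting.
Variables T U : topologicalType.

Lemma continuous_compT (V : topologicalType) (f : T -> U) (g : U -> V) :
  continuous f -> continuous g -> continuous (fun t => g (f t)).
Proof. by move=> cf cg t; apply: continuous_comp; [exact: cf|exact: cg]. Qed.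

Lemma continuous_pair (V : topologicalType) (f : T -> U) (g : T -> V) :
  continuous f -> continuous g -> continuous (fun t => (f t, g t)).
Proof. by move=> cf cg t; apply: cvg_pair; [exact: cf|exact: cg]. Qed.

Lemma continuous_paste (R : realType) (phi : T -> R) (c : R) (f g : T -> U) :
  continuous phi -> continuous f -> continuous g ->
  (forall t, phi t = c -> f t = g t) ->
  continuous (fun t => if phi t <= c then f t else g t).
Proof.
move=> cphi cf cg fg; apply/continuous_subspace_setT.
have -> : [set: T] = phi @^-1` [set x | x <= c] `|` phi @^-1` [set x | c <= x].
  by apply/seteqP; split=> // t _ /=; apply/orP; exact: le_total.
apply: withinU_continuous.
- by apply: preimage_closed; [move=> ? _; exact: cphi|exact: closed_le].
- by apply: preimage_closed; [move=> ? _; exact: cphi|exact: closed_ge].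
- apply: (@subspace_eq_continuous _ _ _ f); last exact: continuous_subspaceT.
  by move=> t /set_mem /= tc; rewrite /from_subspace /= tc.
- apply: (@subspace_eq_continuous _ _ _ g); last exact: continuous_subspaceT.
  move=> t /set_mem /= ct; rewrite /from_subspace /=; case: ifP => // tc; apply/esym/fg/eqP.
  by rewrite eq_le tc ct.
Qed.

End Pasting.

Section PathHomotopy.
Variables (R : realType) (X : topologicalType).
Local Notation I := (I01 R).

Definition path_homotopic (x y : X) (p q : {path I from x to y}) : Prop :=
  exists H : I * I -> X,
    [/\ continuous H, forall t, H (t, zero) = p t, forall t, H (t, one) = q t,
        forall s, H (zero, s) = x & forall s, H (one, s) = y].

Definition path_cat_fun (p q : I -> X) (t : I) : X :=
  if I01val t <= 2^-1 then p (clamp (2 * I01val t))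
  else q (clamp (2 * I01val t - 1)).

Definition path_rev_fun (p : I -> X) (t : I) : X := p (clamp (1 - I01val t)).

Lemma I01val0 : I01val (zero : I) = 0. Proof. by []. Qed.
Lemma I01val1 : I01val (one : I) = 1. Proof. by []. Qed.

Lemma path_cat_continuous (p q : I -> X) : continuous p -> continuous q ->
  p one = q zero -> continuous (path_cat_fun p q).
Proof.
move=> cp cq pq; apply: continuous_paste; first exact: I01val_continuous.
- apply: (continuous_compT _ cp); apply: (continuous_compT _ (@clamp_continuous R)).
  by apply: continuous_mul; [exact: cst_continuous|exact: I01val_continuous].
- apply: (continuous_compT _ cq); apply: (continuous_compT _ (@clamp_continuous R)).
  apply: continuous_sub; last exact: cst_continuous.
  by apply: continuous_mul; [exact: cst_continuous|exact: I01val_continuous].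
- by move=> t ->; rewrite mulfV // subrr clamp0 clamp1.
Qed.

Lemma path_cat0 p q : path_cat_fun p q zero = p zero.
Proof. by rewrite /path_cat_fun I01val0 invr_ge0 ler0n mulr0 clamp0. Qed.

Lemma path_cat1 p q : path_cat_fun p q one = q one.
Proof.
rewrite /path_cat_fun I01val1 lt_geF; last lra.
by rewrite mulr1 -[2]/(1 + 1) addrK clamp1.
Qed.

Lemma path_rev_continuous (p : I -> X) :
  continuous p -> continuous (path_rev_fun p).
Proof.
move=> cp; apply: (continuous_compT _ cp).
apply: (continuous_compT _ (@clamp_continuous R)).
by apply: continuous_sub; [exact: cst_continuous|exact: I01val_continuous].
Qed.

Definition path_cat (x y z : X) (p : {path I from x to y})
    (q : {path I from y to z}) : {path I from x to z} :=
  mk_path (path_cat_continuous (@cts_fun _ _ p) (@cts_fun _ _ q)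
             (etrans (@path_one _ _ _ _ p) (esym (@path_zero _ _ _ _ q))))
          (etrans (path_cat0 p q) (@path_zero _ _ _ _ p))
          (etrans (path_cat1 p q) (@path_one _ _ _ _ q)).

Lemma path_rev0 p : path_rev_fun p zero = p one.
Proof. by rewrite /path_rev_fun I01val0 subr0 clamp1. Qed.

Lemma path_rev1 p : path_rev_fun p one = p zero.
Proof. by rewrite /path_rev_fun I01val1 subrr clamp0. Qed.

Definition path_rev (x y : X) (p : {path I from x to y}) :
    {path I from y to x} :=
  mk_path (path_rev_continuous (@cts_fun _ _ p))
          (etrans (path_rev0 p) (@path_one _ _ _ _ p))
          (etrans (path_rev1 p) (@path_zero _ _ _ _ p)).

Definition path_const (x : X) : {path I from x to x} := cst x.

Lemma fst_cts (T U : topologicalType) : continuous (@fst T U).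
Proof. by move=> ?; exact: cvg_fst. Qed.

Lemma snd_cts (T U : topologicalType) : continuous (@snd T U).
Proof. by move=> ?; exact: cvg_snd. Qed.

Let clC := @clamp_continuous R.
Let valC := @I01val_continuous R.

Lemma double_cts : continuous (fun t : I => clamp (2 * I01val t)).
Proof.
apply: (continuous_compT _ clC).
by apply: continuous_mul; [exact: cst_continuous|exact: valC].
Qed.

Lemma double_sub1_cts : continuous (fun t : I => clamp (2 * I01val t - 1)).
Proof.
apply: (continuous_compT _ clC).
apply: continuous_sub; last exact: cst_continuous.
by apply: continuous_mul; [exact: cst_continuous|exact: valC].
Qed.

Lemma one_sub_cts : continuous (fun t : I => clamp (1 - I01val t)).
Proof.
apply: (continuous_compT _ clC).
by apply: continuous_sub; [exact: cst_continuous|exact: valC].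
Qed.

Section Equivalence.
Variables x y : X.
Implicit Types p q r : {path I from x to y}.

Lemma path_homotopic_refl p : path_homotopic p p.
Proof.
exists (fun z => p z.1); split=> //= [|s|s]; last exact: path_one.
  exact: (continuous_compT (@fst_cts _ _) (@cts_fun _ _ p)).
exact: path_zero.
Qed.

Lemma path_homotopic_sym p q : path_homotopic p q -> path_homotopic q p.
Proof.
move=> [H [cH H0 H1 Hx Hy]].
exists (fun z => H (z.1, clamp (1 - I01val z.2))); split=> //= [|t|t].
- apply: (continuous_compT _ cH); apply: continuous_pair; first exact: fst_cts.
  exact: (continuous_compT (@snd_cts _ _) one_sub_cts).
- by rewrite I01val0 subr0 clamp1.
- by rewrite I01val1 subrr clamp0.
Qed.

Lemma path_homotopic_trans p q r :
  path_homotopic p q -> path_homotopic q r -> path_homotopic p r.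
Proof.
move=> [H [cH H0 H1 Hx Hy]] [K [cK K0 K1 Kx Ky]].
exists (fun z => if I01val z.2 <= 2^-1 then H (z.1, clamp (2 * I01val z.2))
                 else K (z.1, clamp (2 * I01val z.2 - 1))).
split=> /= [|t|t|s|s].
- apply: continuous_paste.
  + exact: (continuous_compT (@snd_cts _ _) valC).
  + apply: (continuous_compT _ cH); apply: continuous_pair; first exact: fst_cts.
    exact: (continuous_compT (@snd_cts _ _) double_cts).
  + apply: (continuous_compT _ cK); apply: continuous_pair; first exact: fst_cts.
    exact: (continuous_compT (@snd_cts _ _) double_sub1_cts).
  + by move=> z ->; rewrite mulfV // subrr clamp0 clamp1 H1 K0.
- by rewrite I01val0 invr_ge0 ler0n mulr0 clamp0.
- rewrite I01val1 lt_geF; last lra.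
  by rewrite mulr1 -[2]/(1 + 1) addrK clamp1.
- by case: ifP.
- by case: ifP.
Qed.

End Equivalence.

Lemma path_cat_homotopic (x y z : X) (p p' : {path I from x to y})
    (q q' : {path I from y to z}) :
  path_homotopic p p' -> path_homotopic q q' ->
  path_homotopic (path_cat p q) (path_cat p' q').
Proof.
move=> [H [cH H0 H1 Hx Hy]] [K [cK K0 K1 Kx Ky]].
exists (fun w => if I01val w.1 <= 2^-1 then H (clamp (2 * I01val w.1), w.2)
                 else K (clamp (2 * I01val w.1 - 1), w.2)).
split=> /= [|t|t|s|s].
- apply: continuous_paste.
  + exact: (continuous_compT (@fst_cts _ _) valC).
  + apply: (continuous_compT _ cH); apply: continuous_pair; last exact: snd_cts.
    exact: (continuous_compT (@fst_cts _ _) double_cts).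
  + apply: (continuous_compT _ cK); apply: continuous_pair; last exact: snd_cts.
    exact: (continuous_compT (@fst_cts _ _) double_sub1_cts).
  + by move=> w ->; rewrite mulfV // subrr clamp0 clamp1 Hy Kx.
- by rewrite H0 K0.
- by rewrite H1 K1.
- by rewrite I01val0 invr_ge0 ler0n mulr0 clamp0.
- rewrite I01val1 lt_geF; last lra.
  by rewrite mulr1 -[2]/(1 + 1) addrK clamp1.
Qed.

Lemma path_rev_homotopic (x y : X) (p q : {path I from x to y}) :
  path_homotopic p q -> path_homotopic (path_rev p) (path_rev q).
Proof.
move=> [H [cH H0 H1 Hx Hy]].
exists (fun w => H (clamp (1 - I01val w.1), w.2)); split=> /= [|t|t|s|s].
- apply: (continuous_compT _ cH); apply: continuous_pair; last exact: snd_cts.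
  exact: (continuous_compT (@fst_cts _ _) one_sub_cts).
- by rewrite H0.
- by rewrite H1.
- by rewrite I01val0 subr0 clamp1.
- by rewrite I01val1 subrr clamp0.
Qed.

Lemma reparam_homotopic (x y : X) (p q : {path I from x to y}) (f : I -> X)
    (u v : I -> R) :
  continuous f -> continuous u -> continuous v ->
  (forall t, p t = f (clamp (u t))) -> (forall t, q t = f (clamp (v t))) ->
  u zero = v zero -> u one = v one -> path_homotopic p q.
Proof.
move=> cf cu cv pE qE uv0 uv1.
exists (fun w => f (clamp (u w.1 + I01val w.2 * (v w.1 - u w.1)))).
split=> /= [|t|t|s|s].
- apply: (continuous_compT _ cf); apply: (continuous_compT _ clC).
  apply: continuous_add; first exact: (continuous_compT (@fst_cts _ _) cu).
  apply: continuous_mul; first exact: (continuous_compT (@snd_cts _ _) valC).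
  apply: continuous_sub; first exact: (continuous_compT (@fst_cts _ _) cv).
  exact: (continuous_compT (@fst_cts _ _) cu).
- by rewrite I01val0 mul0r addr0.
- by rewrite I01val1 mul1r addrC subrK.
- by rewrite uv0 subrr mulr0 addr0 -uv0 -pE path_zero.
- by rewrite uv1 subrr mulr0 addr0 -uv1 -pE path_one.
Qed.

Lemma path_cat_const (x y : X) (p : {path I from x to y}) :
  path_homotopic (path_cat p (path_const y)) p.
Proof.
apply: (@reparam_homotopic _ _ _ _ p (fun t => Num.min 1 (2 * I01val t))
  (fun t => I01val t)).
- exact: cts_fun.
- apply: continuous_min; first exact: cst_continuous.
  by apply: continuous_mul; [exact: cst_continuous|exact: valC].
- exact: valC.
- move=> t; rewrite /path_cat /= /mk_path /path_cat_fun; case: ifP => ht.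
    by rewrite min_r //; lra.
  rewrite min_l ?clamp1 ?path_one //.
  by move/negbT: ht; rewrite -ltNge; lra.
- by move=> t; rewrite I01valK.
- by rewrite I01val0 mulr0 min_r // ler01.
- by rewrite I01val1 mulr1 min_l // ler1n.
Qed.

Lemma path_const_cat (x y : X) (p : {path I from x to y}) :
  path_homotopic (path_cat (path_const x) p) p.
Proof.
apply: (@reparam_homotopic _ _ _ _ p (fun t => Num.max 0 (2 * I01val t - 1))
  (fun t => I01val t)).
- exact: cts_fun.
- apply: continuous_max; first exact: cst_continuous.
  apply: continuous_sub; last exact: cst_continuous.
  by apply: continuous_mul; [exact: cst_continuous|exact: valC].
- exact: valC.
- move=> t; rewrite /path_cat /= /mk_path /path_cat_fun; case: ifP => ht.
    by rewrite max_l ?clamp0 ?path_zero //; lra.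
  by rewrite max_r //; move/negbT: ht; rewrite -ltNge; lra.
- by move=> t; rewrite I01valK.
- by rewrite I01val0 mulr0 max_l //; lra.
- by rewrite I01val1 mulr1 max_r; lra.
Qed.

Lemma path_cat_rev (x y : X) (p : {path I from x to y}) :
  path_homotopic (path_cat p (path_rev p)) (path_const x).
Proof.
apply: (@reparam_homotopic _ _ _ _ p
  (fun t => Num.min (2 * I01val t) (2 - 2 * I01val t)) (fun=> 0)).
- exact: cts_fun.
- apply: continuous_min.
    by apply: continuous_mul; [exact: cst_continuous|exact: valC].
  apply: continuous_sub; first exact: cst_continuous.
  by apply: continuous_mul; [exact: cst_continuous|exact: valC].
- exact: cst_continuous.
- move=> t; have /andP[t0 t1] := I01val_itv t.
  rewrite /path_cat /= /mk_path /path_cat_fun; case: ifP => ht.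
    by rewrite min_l //; lra.
  move/negbT: ht; rewrite -ltNge => ht; rewrite min_r; last lra.
  by rewrite /path_rev_fun clampK; [congr (p (clamp _)); lra|apply/andP; lra].
- by move=> t; rewrite clamp0 path_zero.
- by rewrite I01val0 mulr0 min_l //; lra.
- by rewrite I01val1 mulr1 min_r; lra.
Qed.

Lemma path_rev_cat (x y : X) (p : {path I from x to y}) :
  path_homotopic (path_cat (path_rev p) p) (path_const y).
Proof.
apply: (@reparam_homotopic _ _ _ _ p
  (fun t => Num.max (1 - 2 * I01val t) (2 * I01val t - 1)) (fun=> 1)).
- exact: cts_fun.
- apply: continuous_max.
    apply: continuous_sub; first exact: cst_continuous.
    by apply: continuous_mul; [exact: cst_continuous|exact: valC].
  apply: continuous_sub; last exact: cst_continuous.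
  by apply: continuous_mul; [exact: cst_continuous|exact: valC].
- exact: cst_continuous.
- move=> t; have /andP[t0 t1] := I01val_itv t.
  rewrite /path_cat /= /mk_path /path_cat_fun; case: ifP => ht.
    rewrite max_l; last lra.
    by rewrite /path_rev_fun clampK //; apply/andP; lra.
  by move/negbT: ht; rewrite -ltNge => ht; rewrite max_r //; lra.
- by move=> t; rewrite clamp1 path_one.
- by rewrite I01val0 mulr0 max_l; lra.
- by rewrite I01val1 mulr1 max_r; lra.
Qed.

Lemma path_catA (w x y z : X) (p : {path I from w to x})
    (q : {path I from x to y}) (r : {path I from y to z}) :
  path_homotopic (path_cat p (path_cat q r)) (path_cat (path_cat p q) r).
Proof.
apply: path_homotopic_sym.
apply: (@reparam_homotopic _ _ _ _ (path_cat p (path_cat q r))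
  (fun t => Num.min (2 * I01val t)
              (Num.min (I01val t + 4^-1) ((I01val t + 1) / 2)))
  (fun t => I01val t)).
- exact: cts_fun.
- have c2 : continuous (fun t : I => 2 * I01val t).
    by apply: continuous_mul; [exact: cst_continuous|exact: valC].
  apply: continuous_min => //; apply: continuous_min.
    by apply: continuous_add; [exact: valC|exact: cst_continuous].
  apply: continuous_mul; last exact: cst_continuous.
  by apply: continuous_add; [exact: valC|exact: cst_continuous].
- exact: valC.
- move=> t; have /andP[t0 t1] := I01val_itv t.
  rewrite /path_cat /= /mk_path /path_cat_fun.
  set u := Num.min _ _.
  have [h|h] := leP (I01val t) 2^-1.
    rewrite [I01val (clamp (2 * _))]clampK; last by apply/andP; lra.
    have [h'|h'] := leP (2 * I01val t) 2^-1.
      have -> : u = 2 * I01val t.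
        by rewrite /u min_l // le_min; apply/andP; lra.
      by rewrite clampK ?h' //; apply/andP; lra.
    have -> : u = I01val t + 4^-1.
      by rewrite /u [X in Num.min _ X]min_l ?min_r //; lra.
    rewrite [I01val (clamp (_ + 4^-1))]clampK; last by apply/andP; lra.
    rewrite lt_geF; last lra.
    rewrite clampK; last by apply/andP; lra.
    rewrite ifT; last lra.
    by congr (q (clamp _)); lra.
  have -> : u = (I01val t + 1) / 2.
    by rewrite /u [X in Num.min _ X]min_r ?min_r //; lra.
  rewrite [I01val (clamp (_ / 2))]clampK; last by apply/andP; lra.
  rewrite lt_geF; last lra.
  rewrite clampK; last by apply/andP; lra.
  rewrite lt_geF; last lra.
  by congr (r (clamp _)); lra.
- by move=> t; rewrite I01valK.
- by rewrite I01val0 mulr0 min_l // le_min; apply/andP; lra.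
- rewrite I01val1 min_r; last by rewrite ge_min; apply/orP; left; lra.
  by rewrite min_r; lra.
Qed.

End PathHomotopy.

Section FundamentalGroup.
Variables (R : realType) (X : topologicalType) (x : X).

Definition loop : Type := {path (I01 R) from x to x}.
HB.instance Definition _ := Choice.on loop.

Definition loop_homotopic (p q : loop) : bool := `[< path_homotopic p q >].

Lemma loop_homotopic_equiv : equiv_class_of loop_homotopic.
Proof.
split=> [p|p q|q p r].
- exact/asboolP/path_homotopic_refl.
- by apply/asboolP/asboolP; exact: path_homotopic_sym.
- move=> /asboolP pq /asboolP qr; apply/asboolP.
  exact: path_homotopic_trans pq qr.
Qed.

Canonical loop_homotopic_equiv_rel := EquivRelPack loop_homotopic_equiv.
Canonical loop_homotopic_encModRel := defaultEncModRel loop_homotopic.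

Definition pi1 : Type := {eq_quot loop_homotopic}.
HB.instance Definition _ : EqQuotient loop loop_homotopic pi1 :=
  EqQuotient.on pi1.
HB.instance Definition _ := Choice.on pi1.

Definition pi1_class (p : loop) : pi1 := \pi p.

Lemma pi1_classP (p q : loop) :
  pi1_class p = pi1_class q <-> path_homotopic p q.
Proof.
rewrite /pi1_class; split=> [/eqP|pq]; last apply/eqP.
  by rewrite eqmodE => /asboolP.
by rewrite eqmodE; apply/asboolP.
Qed.

Lemma pi1_ind (P : pi1 -> Prop) : (forall p, P (pi1_class p)) -> forall a, P a.
Proof. by move=> h a; rewrite -[a]reprK; exact: h. Qed.

Definition pi1_one : pi1 := pi1_class (path_const R x).
Definition pi1_mul (a b : pi1) : pi1 := pi1_class (path_cat (repr a) (repr b)).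
Definition pi1_inv (a : pi1) : pi1 := pi1_class (path_rev (repr a)).

Lemma pi1_repr (p : loop) : path_homotopic (repr (pi1_class p)) p.
Proof. by apply/pi1_classP; rewrite /pi1_class reprK. Qed.

Lemma pi1_mulE p q :
  pi1_mul (pi1_class p) (pi1_class q) = pi1_class (path_cat p q).
Proof. by apply/pi1_classP/path_cat_homotopic; exact: pi1_repr. Qed.

Lemma pi1_invE p : pi1_inv (pi1_class p) = pi1_class (path_rev p).
Proof. by apply/pi1_classP/path_rev_homotopic; exact: pi1_repr. Qed.

Lemma pi1_mulA : associative pi1_mul.
Proof.
elim/pi1_ind=> p; elim/pi1_ind=> q; elim/pi1_ind=> r.
by rewrite !pi1_mulE; apply/pi1_classP/path_catA.
Qed.

Lemma pi1_mul1 : left_id pi1_one pi1_mul.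
Proof. by elim/pi1_ind=> p; rewrite pi1_mulE; apply/pi1_classP/path_const_cat. Qed.

Lemma pi1_mul1r : right_id pi1_one pi1_mul.
Proof. by elim/pi1_ind=> p; rewrite pi1_mulE; apply/pi1_classP/path_cat_const. Qed.

Lemma pi1_mulV : left_inverse pi1_one pi1_inv pi1_mul.
Proof.
elim/pi1_ind=> p; rewrite pi1_invE pi1_mulE; exact/pi1_classP/path_rev_cat.
Qed.

Lemma pi1_mulVr : right_inverse pi1_one pi1_inv pi1_mul.
Proof.
elim/pi1_ind=> p; rewrite pi1_invE pi1_mulE; exact/pi1_classP/path_cat_rev.
Qed.

HB.instance Definition _ := isGroup.Build pi1
  pi1_mulA pi1_mul1 pi1_mul1r pi1_mulV pi1_mulVr.

End FundamentalGroup.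

Section Pi1Map.
Variables (R : realType) (X Y : topologicalType) (f : continuousType X Y).
Variables (x : X) (y : Y) (fxy : f x = y).

Lemma map_loop_continuous (p : loop R x) : continuous (fun t => f (p t)).
Proof. exact: (continuous_compT (@cts_fun _ _ p) (@cts_fun _ _ f)). Qed.

Definition map_loop (p : loop R x) : loop R y :=
  mk_path (@map_loop_continuous p)
    (etrans (congr1 f (@path_zero _ _ _ _ p)) fxy)
    (etrans (congr1 f (@path_one _ _ _ _ p)) fxy).

Lemma map_loop_homotopic (p q : loop R x) :
  path_homotopic p q -> path_homotopic (map_loop p) (map_loop q).
Proof.
move=> [H [cH H0 H1 Hx Hy]]; exists (fun z => f (H z)); split=> [|t|t|s|s].
- exact: (continuous_compT cH (@cts_fun _ _ f)).
- by rewrite H0.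
- by rewrite H1.
- by rewrite Hx.
- by rewrite Hy.
Qed.

Definition pi1_map (a : pi1 R x) : pi1 R y := pi1_class (map_loop (repr a)).

Lemma pi1_mapE p : pi1_map (pi1_class p) = pi1_class (map_loop p).
Proof. exact/pi1_classP/map_loop_homotopic/pi1_repr. Qed.

Lemma pi1_mapM : {morph pi1_map : a b / (a * b)%g}.
Proof.
elim/pi1_ind=> p; elim/pi1_ind=> q; rewrite [(_ * _)%g]pi1_mulE !pi1_mapE.
rewrite [RHS]pi1_mulE; congr pi1_class; apply/path_eqP => t.
by rewrite /= /mk_path /= /path_cat_fun; case: ifP.
Qed.

HB.instance Definition _ := isMultiplicative.Build (pi1 R x) (pi1 R y)
  pi1_map pi1_mapM.

End Pi1Map.

Section Coverings.

Definition homeomorphic_via (X Y : topologicalType) (A : set X) (B : set Y)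
    (f : X -> Y) (g : Y -> X) : Prop :=
  [/\ {within A, continuous f}, {within B, continuous g},
      forall x, A x -> B (f x) /\ g (f x) = x &
      forall y, B y -> A (g y) /\ f (g y) = y].

Definition is_manifold (R : realType) (n : nat) (X : topologicalType) : Prop :=
  [/\ hausdorff_space X, @second_countable X &
      forall x : X, exists (U : set X) (V : set 'rV[R]_n)
        (f : X -> 'rV[R]_n) (g : 'rV[R]_n -> X),
        [/\ open U, U x, open V & homeomorphic_via U V f g]].

Definition contractible (R : realType) (X : topologicalType) : Prop :=
  exists (x0 : X) (H : X * I01 R -> X),
    [/\ continuous H, forall x, H (x, zero) = x & forall x, H (x, one) = x0].

Variables (E B : topologicalType).

Definition evenly_covered (p : E -> B) (U : set B) : Prop :=
  exists (J : Type) (V : J -> set E),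
    [/\ forall j, open (V j), trivIset [set: J] V,
        p @^-1` U = \bigcup_j V j &
        forall j, exists s : B -> E, homeomorphic_via (V j) U p s].

Definition covering_map (p : E -> B) : Prop :=
  [/\ continuous p, range p = [set: B] &
      forall b, exists U : set B, [/\ open U, U b & evenly_covered p U]].

Definition connected_cover (p : E -> B) : Prop :=
  covering_map p /\ connected [set: E].

Definition universal_cover (R : realType) (p : E -> B) : Prop :=
  connected_cover p /\ forall (e : E) (a : pi1 R e), a = 1%g.

Definition cover_degree (p : E -> B) (d : nat) : Prop :=
  forall b, (p @^-1` [set b] #= `I_d)%card.

End Coverings.

Section DeckGroup.
Variables (E B : topologicalType) (p : E -> B).

Record deck := Deck {
  deck_fun :> E -> E;
  deck_inv : E -> E;
  deck_continuous : continuous deck_fun;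
  deck_inv_continuous : continuous deck_inv;
  deck_funK : cancel deck_fun deck_inv;
  deck_invK : cancel deck_inv deck_fun;
  deck_over : forall e, p (deck_fun e) = p e
}.

HB.instance Definition _ := gen_eqMixin deck.
HB.instance Definition _ := gen_choiceMixin deck.

Lemma deckP (f g : deck) : f =1 g -> f = g.
Proof.
case: f g => [f f' cf cf' fK f'K fp] [g g' cg cg' gK g'K gp] /= /funext fg.
subst g; have fg' : f' = g'.
  by apply/funext => e; rewrite -{1}(g'K e) fK.
subst g'; congr Deck; exact: Prop_irrelevance.
Qed.

Definition deck_one : deck := @Deck idfun idfun
  (fun _ => cvg_id) (fun _ => cvg_id) (fun=> erefl) (fun=> erefl) (fun=> erefl).

Definition deck_mul (f g : deck) : deck.
Proof.
exists (fun e => f (g e)) (fun e => deck_inv g (deck_inv f e)).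
- exact: (continuous_compT (@deck_continuous g) (@deck_continuous f)).
- exact: (continuous_compT (@deck_inv_continuous f) (@deck_inv_continuous g)).
- by move=> e; rewrite !deck_funK.
- by move=> e; rewrite !deck_invK.
- by move=> e; rewrite !deck_over.
Defined.

Definition deck_invg (f : deck) : deck.
Proof.
exists (deck_inv f) f.
- exact: deck_inv_continuous.
- exact: deck_continuous.
- exact: deck_invK.
- exact: deck_funK.
- by move=> e; rewrite -{2}(deck_invK f e) deck_over.
Defined.

Lemma deck_mulA : associative deck_mul.
Proof. by move=> f g h; exact: deckP. Qed.
Lemma deck_mul1 : left_id deck_one deck_mul.
Proof. by move=> f; exact: deckP. Qed.
Lemma deck_mul1r : right_id deck_one deck_mul.
Proof. by move=> f; exact: deckP. Qed.
Lemma deck_mulV : left_inverse deck_one deck_invg deck_mul.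
Proof. by move=> f; apply: deckP => e /=; rewrite deck_funK. Qed.
Lemma deck_mulVr : right_inverse deck_one deck_invg deck_mul.
Proof. by move=> f; apply: deckP => e /=; rewrite deck_invK. Qed.

HB.instance Definition _ := isGroup.Build deck
  deck_mulA deck_mul1 deck_mul1r deck_mulV deck_mulVr.

Definition regular_cover : Prop :=
  connected_cover p /\
  forall e e', p e = p e' -> exists g : deck, g e = e'.

End DeckGroup.

(* N -> M is a normal closure of M' -> M if it is a regular cover of M
   factoring through M', and is dominated by any other such cover. *)
Definition is_normal_closure (M M' N : topologicalType)
    (p : M' -> M) (q : N -> M) : Prop :=
  [/\ regular_cover q,
      exists2 r : N -> M', continuous r & p \o r = q &
      forall (P : topologicalType) (s : P -> M), regular_cover s ->
        (exists2 t : P -> M', continuous t & p \o t = s) ->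
        exists2 v : P -> N, continuous v & q \o v = s].

Definition same_normal_closure (M M1 M2 : topologicalType)
    (p1 : M1 -> M) (p2 : M2 -> M) : Prop :=
  exists (N : topologicalType) (q : N -> M),
    is_normal_closure p1 q /\ is_normal_closure p2 q.

(* M' -> M is the intermediate cover N/H of the regular cover q : N -> M,
   for a subgroup H of the deck group of q. *)
Definition intermediate_cover (M M' N : topologicalType)
    (q : N -> M) (p : M' -> M) (H : set (deck q)) : Prop :=
  exists r : N -> M', [/\ covering_map r, p \o r = q &
    forall e e', r e = r e' <-> exists2 g : deck q, H g & g e = e'].

Definition integrally_equivalent (M M1 M2 : topologicalType)
    (p1 : M1 -> M) (p2 : M2 -> M) : Prop :=
  exists (N : topologicalType) (q : N -> M) (G1 G2 : set (deck q)),
    [/\ is_normal_closure p1 q, is_normal_closure p2 q,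
        intermediate_cover p1 G1, intermediate_cover p2 G2 &
        integral_gassmann_triple G1 G2].

Definition pi1_image (R : realType) (X Y : topologicalType) (p : continuousType X Y)
    (x : X) (y : Y) (e : p x = y) : set (pi1 R y) := range (@pi1_map R _ _ _ _ _ e).
Arguments pi1_image R {X Y p x y} e.

Definition normalized_iso (G : groupType) (H1 H2 : set G)
    (psi : gmodHom (perm_gmodule H1) (perm_gmodule H2)) : Prop :=
  [/\ bijective psi, forall n, psi (coset_diag H1 n) = coset_diag H2 n &
      forall c, augmentation (psi c) = augmentation c].

(* phi : H_1(M_1) -> H_1(M_2), the composite of Shapiro's isomorphism for M_1,
   the map induced by psi, and the inverse of Shapiro's isomorphism for M_2
   ('pinv_ is the inverse function; its default value 0 is irrelevant since
   the Shapiro maps are bijective). *)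
Definition homology_iso (R : realType) (M M1 M2 : topologicalType)
    (p1 : continuousType M1 M) (p2 : continuousType M2 M)
    (m : M) (m1 : M1) (m2 : M2) (e1 : p1 m1 = m) (e2 : p2 m2 = m)
    (psi : gmodHom (perm_gmodule (pi1_image R e1))
                   (perm_gmodule (pi1_image R e2)))
    (c : H1Z (pi1 R m1)) : H1Z (pi1 R m2) :=
  'pinv_(fun=> 0) [set: H1Z (pi1 R m2)] (shapiro (pi1_map e2))
     (H1_map (gmodHom_coef psi) (shapiro (pi1_map e1) c)).

Definition subgroup_of_index (A : zmodType) (U : set A) (n : nat) : Prop :=
  [/\ U 0, forall a b, U a -> U b -> U (a - b) &
      (range (fun a => [set a + u | u in U]) #= `I_n)%card].

Definition corresponding_covers (R : realType)
    (M M1 M2 M1' M2' : topologicalType)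
    (p1 : continuousType M1 M) (p2 : continuousType M2 M)
    (p1' : continuousType M1' M1) (p2' : continuousType M2' M2)
    (m : M) (m1 : M1) (m2 : M2) (m1' : M1') (m2' : M2')
    (e1 : p1 m1 = m) (e2 : p2 m2 = m) (e1' : p1' m1' = m1) (e2' : p2' m2' = m2)
    (psi : gmodHom (perm_gmodule (pi1_image R e1))
                   (perm_gmodule (pi1_image R e2)))
    (d' : nat) : Prop :=
  exists (U1 : set (H1Z (pi1 R m1))) (U2 : set (H1Z (pi1 R m2))),
    [/\ subgroup_of_index U1 d', subgroup_of_index U2 d',
        homology_iso psi @` U1 = U2,
        pi1_image R e1' = @ab_class (pi1 R m1) @^-1` U1 &
        pi1_image R e2' = @ab_class (pi1 R m2) @^-1` U2].

(* Main.v *)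
Require Import Defs.
From HB Require Import structures.
From mathcomp Require Import all_boot all_order all_algebra.
From mathcomp Require Import all_classical all_reals all_analysis homotopy.
From mathcomp Require Import lra ssrAC.

(** Every lift of the universal cover Mt -> M to M_i' is determined by one of
    its values, and the normal closure of M_i' -> M is the quotient of Mt by the
    group K_i of deck transformations that fix all these lifts. Through the
    monodromy of M_i' -> M, the group K_i is the core of pi_1(M_i') in
    Gamma = pi_1(M), so it remains to see that the two cores coincide.

    If g lies in the core of Gamma_i = pi_1(M_i), then g acts trivially on
    Z[Gamma/Gamma_i], hence a[g] is a cycle for every a in Z[Gamma/Gamma_i],
    and Shapiro's isomorphism maps the class of x^-1 g x in H_1(Gamma_i) to the
    class of x[g]. So g is in the core of pi_1(M_i') iff all the classes a[g] lie
    in the image of U_i, a condition that is carried from i = 1 to i = 2 by the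
    module isomorphism psi. *)

Set Implicit Arguments.
Unset Strict Implicit.
Unset Printing Implicit Defensive.

Import Order.TTheory GRing.Theory Num.Theory.
Import numFieldNormedType.Exports numFieldTopology.Exports.

Local Open Scope classical_set_scope.
Local Open Scope ring_scope.

(** * Unique lifting and homotopy lifting for covering maps *)

Section UniqueLifting.
Variables (E B : topologicalType) (p : E -> B).
Hypothesis cov : covering_map p.

(** The section [s] is total, with irrelevant values off [U]. Its continuity is stated at the points
    of [U] in the ambient topology, which is equivalent to continuity within [U] when [U] is
    open. *)
Definition is_sheet (U : set B) (V : set E) (s : B -> E) : Prop :=
  [/\ open V, forall x, V x -> U (p x) /\ s (p x) = x,
      forall y, U y -> V (s y) /\ p (s y) = y &
      forall y, U y -> {for y, continuous s}].

Lemma covering_sheets b : exists U : set B, [/\ open U, U b &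
  forall e, U (p e) -> exists V s, V e /\ is_sheet U V s].
Proof.
have [_ _ /(_ b)[U [oU Ub [J [V [oV tV VU sV]]]]]] := cov.
exists U; split=> // e Ue.
have : (p @^-1` U) e by [].
rewrite VU => -[j _ Vje]; have [s [_ cs Vs Us]] := sV j.
exists (V j), s; split=> //; split=> // y Uy.
by move: cs; rewrite continuous_open_subspace// => /(_ y); apply; exact/mem_set.
Qed.

Lemma covering_separated e e' : p e = p e' -> e <> e' ->
  exists V V' : set E, [/\ open V, open V', V e, V' e' & V `&` V' = set0].
Proof.
move=> pe ne.
have [_ _ /(_ (p e))[U [oU Ub [J [V [oV tV VU sV]]]]]] := cov.
have : (p @^-1` U) e by [].
have : (p @^-1` U) e' by rewrite /= -pe.
rewrite VU => -[j' _ Vj'e'] [j _ Vje].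
exists (V j), (V j'); split=> //.
apply: contrapT => /eqP/set0P jj'.
move: Vj'e'; rewrite -(tV j j' I I jj') => Vje'.
have [s [_ _ Vs _]] := sV j.
by apply: ne; rewrite -(proj2 (Vs _ Vje)) -(proj2 (Vs _ Vje')) pe.
Qed.

Lemma covering_continuous : continuous p. Proof. by case: cov. Qed.

Lemma covering_surj b : exists e, p e = b.
Proof. by case: cov => _ pT _; have [e _ <-] : range p b; [rewrite pT|exists e]. Qed.

Lemma covering_open (O : set E) : open O -> open (p @` O).
Proof.
move=> oO; rewrite openE => _ [e Oe <-].
have [U [oU Ub /(_ e Ub)[V [s [Ve [oV VU UV cs]]]]]] := covering_sheets (p e).
have se : s (p e) = e by case: (VU _ Ve).
have ns : nbhs (p e) (s @^-1` O).
  by apply: (cs _ Ub); rewrite se; exact: open_nbhs_nbhs.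
apply: filterS (filterI ns (open_nbhs_nbhs (conj oU Ub))) => y [/= Osy Uy].
exists (s y) => //.
by case: (UV _ Uy).
Qed.

(** The set where [f] and [g] agree is clopen. It is open because two lifts in the same sheet
    coincide there, and closed because distinct points of a fibre lie in disjoint sheets. *)
Lemma unique_lifting (Y : topologicalType) (f g : Y -> E) (y0 : Y) :
  connected [set: Y] -> continuous f -> continuous g ->
  (forall y, p (f y) = p (g y)) -> f y0 = g y0 -> f =1 g.
Proof.
move=> cY cf cg pfg fg0.
suff fgT : [set y | f y = g y] = [set: Y].
  by move=> y; have : [set: Y] y by []; rewrite -fgT.
apply: cY; first by exists y0.
- exists [set y | f y = g y]; last by rewrite setTI.
  rewrite openE => y /= fgy.
  have [U [oU Ub /(_ (f y) Ub)[V [s [Ve [oV VU UV cs]]]]]] :=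
    covering_sheets (p (f y)).
  have nf : nbhs y (f @^-1` V) by apply: cf; exact: open_nbhs_nbhs.
  have ng : nbhs y (g @^-1` V).
    by apply: cg; rewrite -fgy; exact: open_nbhs_nbhs.
  apply: filterS (filterI nf ng) => z [/= Vf Vg].
  by rewrite -(proj2 (VU _ Vf)) -(proj2 (VU _ Vg)) pfg.
exists [set y | f y = g y]; last by rewrite setTI.
rewrite -[X in closed X]setCK closedC openE => y /= fgy.
have [V [V' [oV oV' Vf Vg VV']]] := covering_separated (pfg y) fgy.
have nf : nbhs y (f @^-1` V) by apply: cf; exact: open_nbhs_nbhs.
have ng : nbhs y (g @^-1` V') by apply: cg; exact: open_nbhs_nbhs.
apply: filterS (filterI nf ng) => z [/= Vfz Vgz] fgz.
have : (V `&` V') (f z) by split; rewrite ?fgz // -fgz.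
by rewrite VV'.
Qed.

Lemma lift_open (Y : topologicalType) (f : Y -> E) :
  continuous f -> (forall O, open O -> open ((p \o f) @` O)) ->
  forall O, open O -> open (f @` O).
Proof.
move=> cf opf O oO; rewrite openE => _ [y Oy <-].
have [U [oU Ub /(_ (f y) Ub)[V [s [Ve [oV VU UV cs]]]]]] :=
  covering_sheets (p (f y)).
have oO' : open (O `&` f @^-1` V).
  by apply: openI => //; apply: open_comp => // z _; exact: cf.
have ov : open (V `&` p @^-1` ((p \o f) @` (O `&` f @^-1` V))).
  apply: openI => //; apply: open_comp; last exact: opf.
  by move=> z _; exact: covering_continuous.
have : open_nbhs (f y) (V `&` p @^-1` ((p \o f) @` (O `&` f @^-1` V))).
  by split=> //; split=> //; exists y.
move=> /open_nbhs_nbhs nW; apply: filterS nW => z [Vz [w [Ow /= Vfw] pw]].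
by exists w => //; rewrite -(proj2 (VU _ Vz)) -(proj2 (VU _ Vfw)) pw.
Qed.

End UniqueLifting.

(** The local condition makes [P] locally constant on [[0, 1]]; it is applied at the supremum of the
    points of the interval where [P] holds. *)
Lemma real_induction (R : realType) (P : R -> Prop) : P 0 ->
  (forall c, 0 <= c <= 1 -> exists2 e, 0 < e &
     forall t t', 0 <= t <= 1 -> 0 <= t' <= 1 -> `|t - c| < e -> `|t' - c| < e ->
       P t -> P t') ->
  P 1.
Proof.
move=> P0 Ploc.
pose A := [set t : R | 0 <= t <= 1 /\ P t].
have A0 : A 0 by split=> //; rewrite lexx ler01.
have supA : has_sup A by split; [exists 0|exists 1 => t [/andP[]]].
have ubA : forall t, A t -> t <= sup A by exact: ub_le_sup (proj2 supA).
have c0 : 0 <= sup A by exact: ubA.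
have c1 : sup A <= 1 by apply: ge_sup => //; [exists 0|move=> t [/andP[]]].
have [|e e0 He] := Ploc (sup A); first by rewrite c0 c1.
have [t [t01 Pt] tc] := sup_adherent e0 supA.
have tsup : t <= sup A by apply: ubA.
have tc' : `|t - sup A| < e by rewrite ltr_norml; apply/andP; lra.
(* Either [sup A + e / 2] still lies in the interval, and [P] there contradicts the choice of the
   supremum, or [1] is itself within [e] of the supremum. *)
have [h|h] := leP (sup A + e / 2) 1.
  have /ubA : A (sup A + e / 2).
    split; first by apply/andP; lra.
    apply: (He t) => //; first by apply/andP; lra.
    by rewrite ltr_norml; apply/andP; lra.
  lra.
apply: (He t) => //; first by rewrite lexx ler01.
by rewrite ltr_norml; apply/andP; lra.
Qed.

(** This pointwise form of pasting asks for continuity of [g] only at points with [c <= phi z]: in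
    the application [g] is built from a local section, which is controlled only over its evenly
    covered set. *)
Lemma continuous_at_paste (R : realType) (T U : topologicalType)
    (phi : T -> R) (c : R) (f g : T -> U) (z : T) :
  {for z, continuous phi} -> {for z, continuous f} ->
  (c <= phi z -> {for z, continuous g}) -> (phi z = c -> f z = g z) ->
  {for z, continuous (fun t => if phi t <= c then f t else g t)}.
Proof.
move=> cphi cf cg fg A /= nA.
suff : nbhs z [set t | A (if phi t <= c then f t else g t)] by [].
move: nA; case: (ltgtP (phi z) c) => [zc|cz|zc] nA.
- have n1 : nbhs z (phi @^-1` [set x | x < c]).
    by apply: cphi; apply: open_nbhs_nbhs; split=> //; exact: open_lt.
  have nf : nbhs z (f @^-1` A) by exact: cf.
  by apply: filterS (filterI n1 nf) => w [/= /ltW ->].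
- have n1 : nbhs z (phi @^-1` [set x | x > c]).
    by apply: cphi; apply: open_nbhs_nbhs; split=> //; exact: open_gt.
  have ng : nbhs z (g @^-1` A) by exact: (cg (ltW cz)).
  by apply: filterS (filterI n1 ng) => w [/= cw]; rewrite lt_geF.
- have nf : nbhs z (f @^-1` A) by exact: cf.
  have ng : nbhs z (g @^-1` A) by apply: cg; rewrite ?zc -?fg.
  by apply: filterS (filterI nf ng) => w [/= fA gA]; case: ifP.
Qed.

Section HomotopyLifting.
Variables (R : realType) (E B : topologicalType) (p : E -> B).
Hypothesis cov : covering_map p.
Variables (Y : topologicalType) (F : Y * R -> B) (f0 : Y -> E).
Hypotheses (cF : continuous F) (cf0 : continuous f0).
Hypothesis pf0 : forall y, p (f0 y) = F (y, 0).
Hypothesis F_le0 : forall y t, t <= 0 -> F (y, t) = F (y, 0).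

(** A lift near [y0] of the homotopy frozen from time [tau] on. Freezing keeps all of [R] as time
    domain, so that the induction on [tau] never changes the domain of [G]. *)
Definition stopped_lift (y0 : Y) (tau : R) (N : set Y) (G : Y * R -> E) : Prop :=
  [/\ open N, N y0, forall y t, N y -> {for (y, t), continuous G},
      forall y t, N y -> p (G (y, t)) = F (y, Num.min t tau) &
      forall y, N y -> G (y, 0) = f0 y].

Lemma pair_cts (y : Y) : continuous (fun t : R => (y, t)).
Proof. by apply: continuous_pair; [exact: cst_continuous|move=> ?; exact: cvg_id]. Qed.

Lemma pairl_cts (t : R) : continuous (fun y : Y => (y, t)).
Proof. by apply: continuous_pair; [move=> ?; exact: cvg_id|exact: cst_continuous]. Qed.

Lemma stopped_lift_at0 y0 : exists N G, stopped_lift y0 0 N G.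
Proof.
exists setT, (fun z => f0 z.1); split=> //; first exact: openT.
- by move=> y t _; apply: (continuous_compT (@fst_cts _ _) cf0).
- by move=> y t _ /=; rewrite pf0 F_le0 // ge_min lexx orbT.
Qed.

(** For times near [c] and [y] near [y0], the values of [F] stay in one evenly covered [U]. To go
    back to [t' <= t], freeze [G] at [t']; to advance to [t' > t], continue [G] after time [t] by
    the section of the sheet containing [G (y0, t)], over a smaller neighbourhood of [y0]. *)
Lemma stopped_lift_extend y0 c : 0 <= c <= 1 -> exists2 e, 0 < e &
  forall t t', 0 <= t <= 1 -> 0 <= t' <= 1 -> `|t - c| < e -> `|t' - c| < e ->
    (exists N G, stopped_lift y0 t N G) -> exists N G, stopped_lift y0 t' N G.
Proof.
move=> _; have [U [oU Uc sheetU]] := covering_sheets cov (F (y0, c)).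
have /cF : nbhs (F (y0, c)) U by exact: open_nbhs_nbhs.
case=> -[/= N1 I1] [nN1 nI1] NI.
have /nbhs_ballP[e /= e0 ballI] := nI1.
move: nN1; rewrite nbhsE => -[N1' [oN1' N1'y0] sN1].
have FU y t : N1' y -> `|t - c| < e -> U (F (y, t)).
  move=> N1y tc; apply: (NI (y, t)); split=> /=; first exact: sN1.
  by apply: ballI; rewrite /ball /= distrC.
exists e => // t t' t01 t'01 tc t'c [N [G [oN Ny0 cG pG G0]]].
have [t't|tt'] := leP t' t.
  exists N, (fun z => G (z.1, Num.min z.2 t')); split=> //.
  - move=> y r Ny.
    apply: (@continuous_comp _ _ _ (fun z : Y * R => (z.1, Num.min z.2 t')) G).
      apply: continuous_pair; first exact: fst_cts.
      by apply: Defs.continuous_min; [exact: snd_cts|exact: cst_continuous].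
    exact: cG.
  - by move=> y r Ny /=; rewrite pG // -minA [Num.min t' t]min_l.
  - by move=> y Ny /=; rewrite min_l ?G0//; case/andP: t'01.
have UG : U (p (G (y0, t))) by rewrite pG // min_l //; exact: FU.
have [V [s [VG [oV VU UV cs]]]] := sheetU _ UG.
have : nbhs y0 ((fun y => G (y, t)) @^-1` V).
  have cGt : {for y0, continuous (fun y => G (y, t))}.
    apply: (@continuous_comp _ _ _ (fun y : Y => (y, t)) G); first exact: pairl_cts.
    exact: cG.
  by apply: cGt; exact: open_nbhs_nbhs.
rewrite nbhsE => -[N2 [oN2 N2y0] sN2].
exists (N `&` N1' `&` N2).
exists (fun z => if z.2 <= t then G z else s (F (z.1, Num.min z.2 t'))).
have Gs y : (N `&` N1' `&` N2) y -> G (y, t) = s (F (y, t)).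
  move=> [[Ny N1y] N2y]; have [_ <-] := VU _ (sN2 _ N2y).
  by rewrite pG // min_l.
split=> //.
- by apply: openI => //; exact: openI.
- move=> y r Ny; have [[NNy N1y] N2y] := Ny.
  apply: (@continuous_at_paste R _ _ (@snd Y R) t G).
  + exact: snd_cts.
  + exact: cG.
  + move=> /= tr.
    apply: (@continuous_comp _ _ _ (fun z : Y * R => F (z.1, Num.min z.2 t')) s).
      apply: (@continuous_compT _ _ _ (fun z : Y * R => (z.1, Num.min z.2 t')) F) => //.
      apply: continuous_pair; first exact: fst_cts.
      by apply: Defs.continuous_min; [exact: snd_cts|exact: cst_continuous].
    apply: cs; apply: FU => //=; move: tc t'c; rewrite !ltr_norml.
    by case: (leP r t') => rt' /andP[? ?] /andP[? ?]; apply/andP; lra.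
  + by move=> /= ->; rewrite min_l ?Gs// ltW.
- move=> y r Ny; have [[NNy N1y] N2y] := Ny; case: ifP => /= rt.
    by rewrite pG // !min_l // (le_trans rt) // ltW.
  move/negbT: rt; rewrite -ltNge => tr.
  have /UV[] // : U (F (y, Num.min r t')).
  apply: FU => //=; move: tc t'c; rewrite !ltr_norml.
  by case: (leP r t') => rt' /andP[? ?] /andP[? ?]; apply/andP; lra.
- by move=> y [[Ny _] _] /=; rewrite ifT ?G0//; case/andP: t01.
Qed.

Lemma stopped_lift_full y0 : exists N G, stopped_lift y0 1 N G.
Proof.
apply: (@real_induction R (fun t => exists N G, stopped_lift y0 t N G)).
  exact: stopped_lift_at0.
exact: stopped_lift_extend.
Qed.

Lemma connectedR : connected [set: R].
Proof. exact/connected_intervalP. Qed.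

(** Local lifts agree on overlaps by unique lifting along each line [{y'} x R], so the diagonal
    choice [G y (y, t)] coincides near each point with a single continuous local lift. *)
Lemma homotopy_liftingR : exists G : Y * R -> E,
  [/\ continuous G, forall y t, p (G (y, t)) = F (y, Num.min t 1) &
      forall y, G (y, 0) = f0 y].
Proof.
have [N hN] := choice stopped_lift_full; have [G hG] := choice hN.
have GE y y' t : N y y' -> G y (y', t) = G y' (y', t).
  move=> Ny; have [oN Ny0 cG pG G0] := hG y; have [oN' Ny0' cG' pG' G0'] := hG y'.
  apply: (@unique_lifting _ _ _ cov R (fun t => G y (y', t)) (fun t => G y' (y', t)) 0).
  - exact: connectedR.
  - move=> r; apply: (@continuous_comp _ _ _ (fun t : R => (y', t)) (G y)).
      exact: pair_cts.
    exact: cG.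
  - move=> r; apply: (@continuous_comp _ _ _ (fun t : R => (y', t)) (G y')).
      exact: pair_cts.
    exact: cG'.
  - by move=> r; rewrite pG // pG'.
  - by rewrite G0 // G0'.
exists (fun z => G z.1 z); split=> [[y t]|y t|y]; last 2 first.
- by have [_ Ny _ pG _] := hG y; rewrite /= pG.
- by have [_ Ny _ _ G0] := hG y; rewrite /= G0.
have [oN Ny cG _ _] := hG y.
have nN : nbhs (y, t) ((@fst Y R) @^-1` (N y)).
  by apply: fst_cts; exact: open_nbhs_nbhs.
move=> A /= nA; have nG : nbhs (y, t) (G y @^-1` A) by exact: cG.
suff : nbhs (y, t) [set z | A (G z.1 z)] by [].
apply: filterS (filterI nN nG) => -[y' t'] /= [Ny'].
by rewrite (GE y y').
Qed.

End HomotopyLifting.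

Lemma connectedI01 (R : realType) : connected [set: I01 R].
Proof.
have -> : [set: I01 R] = @clamp R @` [set: R].
  by apply/seteqP; split=> // t _; exists (I01val t) => //; rewrite I01valK.
apply: connected_continuous_connected; first exact: connectedR.
by apply: continuous_subspaceT; exact: clamp_continuous.
Qed.

Lemma homotopy_lifting (R : realType) (E B Y : topologicalType) (p : E -> B)
    (F : Y * I01 R -> B) (f0 : Y -> E) :
  covering_map p -> continuous F -> continuous f0 ->
  (forall y, p (f0 y) = F (y, zero)) ->
  exists G : Y * I01 R -> E,
    [/\ continuous G, forall z, p (G z) = F z & forall y, G (y, zero) = f0 y].
Proof.
move=> cov cF cf0 pf0.
have cid : continuous (fun z : Y * R => (z.1, clamp z.2)).
  apply: continuous_pair; first exact: fst_cts.
  exact: (continuous_compT (@snd_cts _ _) (@clamp_continuous R)).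
have [||y t t0|G [cG pG G0]] := @homotopy_liftingR R E B p cov Y
    (fun z => F (z.1, clamp z.2)) f0 _ cf0.
- exact: (continuous_compT cid cF).
- by move=> y /=; rewrite pf0 clamp0.
- by rewrite /= clamp_le0 // clamp0.
exists (fun z => G (z.1, I01val z.2)); split.
- apply: (continuous_compT _ cG); apply: continuous_pair; first exact: fst_cts.
  exact: (continuous_compT (@snd_cts _ _) (@I01val_continuous R)).
- move=> [y t] /=; rewrite pG /= min_l; first by rewrite I01valK.
  by have /andP[] := I01val_itv t.
- by move=> y /=; rewrite I01val0 G0.
Qed.

Section Paths.
Variable R : realType.

Lemma path_lifting (E B : topologicalType) (p : E -> B) (a : I01 R -> B) y :
  covering_map p -> continuous a -> p y = a zero ->
  exists b : I01 R -> E,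
    [/\ continuous b, forall s, p (b s) = a s & b zero = y].
Proof.
move=> cov ca pya.
(* The path is viewed as a homotopy that is constant in its first variable. *)
have [||G [cG pG G0]] := @homotopy_lifting R E B (I01 R) p (fun z => a z.2)
    (cst y) cov _ _ (fun=> pya).
- exact: (continuous_compT (@snd_cts _ _) ca).
- exact: cst_continuous.
exists (fun s => G (zero, s)); split=> //.
apply: (continuous_compT _ cG).
by apply: continuous_pair; [exact: cst_continuous|move=> ?; exact: cvg_id].
Qed.

(** Lift [H] starting from [a]; unique lifting then identifies the two vertical sides with constants
    and the top with [b]. That [a] and [b] have the same end is part of the outcome. *)
Lemma path_homotopy_lifting (E B : topologicalType) (p : E -> B)
    (H : I01 R * I01 R -> B) (a b : I01 R -> E) :
  covering_map p -> continuous H -> continuous a -> continuous b ->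
  (forall t, H (t, zero) = p (a t)) -> (forall t, H (t, one) = p (b t)) ->
  (forall s, H (zero, s) = p (a zero)) -> (forall s, H (one, s) = p (a one)) ->
  a zero = b zero ->
  exists G : I01 R * I01 R -> E,
    [/\ continuous G, forall t, G (t, zero) = a t, forall t, G (t, one) = b t,
        forall s, G (zero, s) = a zero & forall s, G (one, s) = a one].
Proof.
move=> cov cH ca cb Ha Hb H0 H1 ab0.
have [|G [cG pG G0]] := @homotopy_lifting R E B (I01 R) p H a cov cH ca.
  by move=> t; rewrite Ha.
have cGl s : continuous (fun t => G (t, s)).
  apply: (continuous_compT _ cG).
  by apply: continuous_pair; [move=> ?; exact: cvg_id|exact: cst_continuous].
have cGr t : continuous (fun s => G (t, s)).
  apply: (continuous_compT _ cG).
  by apply: continuous_pair; [exact: cst_continuous|move=> ?; exact: cvg_id].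
have G0s s : G (zero, s) = a zero.
  apply: (@unique_lifting _ _ _ cov _ (fun s => G (zero, s)) (cst (a zero)) zero).
  - exact: connectedI01.
  - exact: cGr.
  - exact: cst_continuous.
  - by move=> r; rewrite pG H0.
  - by rewrite G0.
exists G; split=> // [t|s].
- apply: (@unique_lifting _ _ _ cov _ (fun t => G (t, one)) b zero) => //.
  + exact: connectedI01.
  + by move=> r; rewrite pG Hb.
  + by rewrite G0s.
- apply: (@unique_lifting _ _ _ cov _ (fun s => G (one, s)) (cst (a one)) zero).
  + exact: connectedI01.
  + exact: cGr.
  + exact: cst_continuous.
  + by move=> r; rewrite pG H1.
  + by rewrite G0.
Qed.

End Paths.

(** * Paths in a contractible space and lifts of maps out of it *)

Section Contractible.
Variables (R : realType) (X : topologicalType).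
Hypothesis contrX : contractible R X.

Lemma contractible_path (x y : X) :
  exists a : I01 R -> X, [/\ continuous a, a zero = x & a one = y].
Proof.
have [x0 [H [cH H0 H1]]] := contrX.
have cHx z : continuous (fun s => H (z, s)).
  apply: (continuous_compT _ cH).
  by apply: continuous_pair; [exact: cst_continuous|move=> ?; exact: cvg_id].
exists (path_cat_fun (fun s => H (x, s)) (path_rev_fun (fun s => H (y, s)))).
split.
- apply: path_cat_continuous => //; first exact: path_rev_continuous.
  by rewrite path_rev0 !H1.
- by rewrite path_cat0 H0.
- by rewrite path_cat1 path_rev1 H0.
Qed.

(** The reversed contraction composed with [f] is a homotopy from a constant map to [f], and a
    constant map lifts. *)
Lemma contractible_lift (E B : topologicalType) (p : E -> B) (f : X -> B) x y :
  covering_map p -> continuous f -> p y = f x ->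
  exists t : X -> E, [/\ continuous t, forall z, p (t z) = f z & t x = y].
Proof.
move=> cov cf pyx; have [x0 [H [cH H0 H1]]] := contrX.
have cHx z : continuous (fun s => H (z, s)).
  apply: (continuous_compT _ cH).
  by apply: continuous_pair; [exact: cst_continuous|move=> ?; exact: cvg_id].
(* The track of [x] is lifted from [y]. Starting the lifted homotopy at the end [b one] makes it run
   back along [b] over [x], so the final lift sends [x] to [y]. *)
have [||b [cb pb b0]] := @path_lifting R E B p (fun s => f (H (x, s))) y cov.
- exact: (continuous_compT (cHx x) cf).
- by rewrite H0.
pose F (z : X * I01 R) := f (H (z.1, clamp (1 - I01val z.2))).
have cF : continuous F.
  apply: (continuous_compT _ cf); apply: (continuous_compT _ cH).
  apply: continuous_pair; first exact: fst_cts.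
  exact: (continuous_compT (@snd_cts _ _) (@one_sub_cts R)).
have [||G [cG pG G0]] := @homotopy_lifting R E B X p F (cst (b one)) cov cF.
- exact: cst_continuous.
- by move=> z; rewrite /F /= I01val0 subr0 clamp1 pb !H1.
exists (fun z => G (z, one)); split.
- apply: (continuous_compT _ cG).
  by apply: continuous_pair; [move=> ?; exact: cvg_id|exact: cst_continuous].
- by move=> z; rewrite pG /F /= I01val1 subrr clamp0 H0.
rewrite -b0 -(path_rev1 b).
apply: (@unique_lifting _ _ _ cov _ (fun s => G (x, s)) (path_rev_fun b) zero).
- exact: connectedI01.
- apply: (continuous_compT _ cG).
  by apply: continuous_pair; [exact: cst_continuous|move=> ?; exact: cvg_id].
- exact: path_rev_continuous.
- by move=> s; rewrite pG /path_rev_fun pb.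
- by rewrite G0 path_rev0.
Qed.

End Contractible.

(** * Lifts of the universal cover through covers and composites of covers *)

Section LiftsOfUniversalCover.
Variables (R : realType) (M Mt : topologicalType) (u : Mt -> M).
Hypotheses (covu : covering_map u) (connMt : connected [set: Mt]).
Hypothesis contrMt : contractible R Mt.

Definition is_lift (E : topologicalType) (p : E -> M) (t : Mt -> E) : Prop :=
  continuous t /\ forall x, p (t x) = u x.

(* The part of covering theory that is inherited by composites of covers,
   which need not be covering maps. *)
Definition lift_property (E : topologicalType) (p : E -> M) : Prop :=
  [/\ forall x y, p y = u x -> exists2 t, is_lift p t & t x = y,
      forall t t' x, is_lift p t -> is_lift p t' -> t x = t' x -> t =1 t' &
      forall t O, is_lift p t -> open O -> open (t @` O)].

Lemma covering_lift_property (E : topologicalType) (p : E -> M) :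
  covering_map p -> lift_property p.
Proof.
move=> cov; split=> [x y pyx|t t' x [ct pt] [ct' pt'] tt'x|t O [ct pt] oO].
- have [t [ct pt tx]] := contractible_lift contrMt cov (covering_continuous covu) pyx.
  by exists t.
- by apply: (unique_lifting cov connMt ct ct' _ tt'x) => y; rewrite pt pt'.
- apply: (lift_open cov ct _ oO) => O' oO'.
  by rewrite (_ : p \o t = u); [exact: covering_open|apply/funext].
Qed.

(** Everything is done in two stages: a lift through [p] is a map out of the contractible space
    [Mt], and so lifts again through [p']. *)
Lemma lift_property_comp (E E' : topologicalType) (p : E -> M) (p' : E' -> E) :
  continuous p -> lift_property p -> covering_map p' -> lift_property (p \o p').
Proof.
move=> cp [ex uq op] cov'; have cp' := covering_continuous cov'.
have lift_p t : is_lift (p \o p') t -> is_lift p (p' \o t).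
  by move=> [ct pt]; split=> //; exact: (continuous_compT ct cp').
split=> [x y pyx|t t' x lt lt' tt'x|t O lt oO].
- have [t [ct pt] tx] := ex x (p' y) pyx.
  have [t' [ct' pt' tx']] := contractible_lift contrMt cov' ct (esym tx).
  by exists t' => //; split=> // z /=; rewrite pt' pt.
- apply: (unique_lifting cov' connMt lt.1 lt'.1 _ tt'x) => y.
  by apply: (uq _ _ x (lift_p _ lt) (lift_p _ lt')); rewrite /= tt'x.
- by apply: (lift_open cov' lt.1 _ oO) => O' oO'; apply: op => //; exact: lift_p.
Qed.

Lemma deck_lift (g : deck u) (E : topologicalType) (p : E -> M) t :
  is_lift p t -> is_lift p (t \o g).
Proof.
move=> [ct pt]; split=> [|x /=]; last by rewrite pt deck_over.
exact: (continuous_compT (@deck_continuous _ _ _ g) ct).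
Qed.

(** Lift [u] through itself once with [x] going to [y] and once with [y] going to [x]; by uniqueness
    the two lifts are mutually inverse. *)
Lemma deck_transitive x y : u x = u y -> exists g : deck u, g x = y.
Proof.
move=> uxy; have [ex uq _] := covering_lift_property covu.
have [g [cg ug] gx] := ex x y (esym uxy).
have [h [ch uh] hy] := ex y x uxy.
have idl : is_lift u idfun by split=> // z; exact: cvg_id.
have gK : cancel g h.
  apply: (uq (h \o g) idfun x) => //=; last by rewrite gx hy.
  by split=> [|z /=]; [exact: (continuous_compT cg ch)|rewrite uh ug].
have hK : cancel h g.
  apply: (uq (g \o h) idfun y) => //=; last by rewrite hy gx.
  by split=> [|z /=]; [exact: (continuous_compT ch cg)|rewrite ug uh].
by exists (Deck cg ch gK hK ug).
Qed.

Lemma deck_free (g h : deck u) x : g x = h x -> g = h.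
Proof.
move=> gh; apply: deckP; have [_ uq _] := covering_lift_property covu.
by apply: (uq _ _ x) => //; split;
  [exact: deck_continuous|exact: deck_over|exact: deck_continuous|exact: deck_over].
Qed.

(** The ranges of lifts are open and cover [E]. Two of them that meet coincide, since the lifts then
    differ by a deck transformation; so the range of [t] is clopen. *)
Lemma lift_surj (E : topologicalType) (p : E -> M) t :
  lift_property p -> connected [set: E] -> is_lift p t ->
  forall y, exists x, t x = y.
Proof.
move=> [ex uq op] connE lt.
suff tT : range t = [set: E].
  by move=> y; have [x _ <-] : range t y; [rewrite tT|exists x].
have same_range t' y : is_lift p t' -> range t y -> range t' y -> range t' `<=` range t.
  move=> lt' [x _ <-] [x' _ tt'] _ [z _ <-].
  have [g gx'] : exists g : deck u, g x' = x.
    by apply: deck_transitive; rewrite -(lt.2 x) -(lt'.2 x') tt'.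
  exists (g z) => //; apply: (uq (t \o g) t' x') => //=; first exact: deck_lift.
  by rewrite gx' tt'.
have ot : open (range t) by apply: op => //; exact: openT.
apply: connE; last 2 first.
- by exists (range t); rewrite ?setTI.
- exists (range t); rewrite ?setTI // -[X in closed X]setCK closedC openE => y nty.
  have [x ux] := covering_surj covu (p y).
  have [t' lt' t'x] := ex x y (esym ux).
  have ot' : open (range t') by apply: op => //; exact: openT.
  have : nbhs y (range t').
    by apply: open_nbhs_nbhs; split=> //; exists x.
  move=> nt'; apply: filterS nt' => z t'z tz; apply: nty.
  by apply: (same_range t' z) => //; exists x.
have [x0 _] := contrMt.
by exists (t x0), x0.
Qed.

End LiftsOfUniversalCover.

(** * Orbit spaces of deck groups and normal closures *)

Section OrbitSpace.
Local Open Scope quotient_scope.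
Variables (R : realType) (M Mt : topologicalType) (u : Mt -> M).
Hypotheses (covu : covering_map u) (connMt : connected [set: Mt]).
Hypothesis contrMt : contractible R Mt.
Variable K : set (deck u).
Hypothesis sK : is_subgroup K.

Definition orbit_relb (x y : Mt) : bool := `[< exists2 g : deck u, K g & g x = y >].

Lemma orbit_relb_refl : reflexive orbit_relb.
Proof. by case: sK => K1 _ _ x; apply/asboolP; exists 1%g. Qed.

Lemma orbit_relb_sym : symmetric orbit_relb.
Proof.
case: sK => _ _ KV.
suff sym x y : orbit_relb x y -> orbit_relb y x by move=> x y; apply/idP/idP; exact: sym.
move=> /asboolP[g Kg <-]; apply/asboolP; exists g^-1%g; first exact: KV.
exact: deck_funK.
Qed.

Lemma orbit_relb_trans : transitive orbit_relb.
Proof.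
case: sK => _ KM _ y x z /asboolP[g Kg <-] /asboolP[h Kh <-].
by apply/asboolP; exists (h * g)%g => //; exact: KM.
Qed.

Definition orbit_rel := EquivRel _ orbit_relb_refl orbit_relb_sym orbit_relb_trans.

Definition orbit_space : Type := {eq_quot orbit_rel}.
HB.instance Definition _ := Quotient.on orbit_space.
HB.instance Definition _ := Topological.copy orbit_space (quotient_topology orbit_space).

Definition orbit_pi : Mt -> orbit_space := \pi_orbit_space.

Lemma orbit_piP x y : orbit_pi x = orbit_pi y <-> exists2 g : deck u, K g & g x = y.
Proof.
by split=> [/eqmodP/asboolP|h]; last by apply/eqmodP/asboolP.
Qed.

Lemma orbit_pi_surj n : exists x, orbit_pi x = n.
Proof. by exists (repr n); exact: reprK. Qed.

Lemma orbit_pi_continuous : continuous orbit_pi.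
Proof. exact: pi_continuous. Qed.

Lemma orbit_factor (Z : topologicalType) (f : Mt -> Z) : continuous f ->
  (forall x (g : deck u), K g -> f (g x) = f x) ->
  exists2 h : orbit_space -> Z, continuous h & forall x, h (orbit_pi x) = f x.
Proof.
move=> cf fK; have fE x : f (repr (orbit_pi x)) = f x.
  have /orbit_piP[g Kg gx] : orbit_pi (repr (orbit_pi x)) = orbit_pi x.
    by rewrite /orbit_pi reprK.
  by rewrite -[in RHS]gx fK.
exists (f \o repr) => //; apply/quotient_continuous.
by rewrite (_ : _ \o _ = f) //; apply/funext.
Qed.

Lemma orbit_pi_open O : open O -> open (orbit_pi @` O).
Proof.
move=> oO; rewrite /open /= /quotient_open.
have -> : \pi_orbit_space @^-1` (orbit_pi @` O) = \bigcup_(g in K) (g @^-1` O).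
  apply/seteqP; split=> [x [y Oy /esym/orbit_piP[g Kg gx]]|x [g Kg /= Ogx]].
    by exists g => //=; rewrite gx.
  by exists (g x) => //; apply/esym/orbit_piP; exists g.
apply: bigcup_open => g _; apply: open_comp => // x _; exact: deck_continuous.
Qed.

Definition orbit_map (n : orbit_space) : M := u (repr n).

Lemma orbit_map_pi x : orbit_map (orbit_pi x) = u x.
Proof.
have /orbit_piP[g Kg gx] : orbit_pi (repr (orbit_pi x)) = orbit_pi x.
  by rewrite /orbit_pi reprK.
by rewrite -[in RHS]gx deck_over.
Qed.

Lemma orbit_map_continuous : continuous orbit_map.
Proof.
apply/quotient_continuous; rewrite (_ : _ \o _ = u).
  exact: covering_continuous.
by apply/funext => x; exact: orbit_map_pi.
Qed.

(* The sheets over U are the images of the translates g V of one sheet V of u,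
   so no connectedness of U is needed. *)
Lemma orbit_map_covering : covering_map orbit_map.
Proof.
split; first exact: orbit_map_continuous.
  apply/seteqP; split=> // b _; have [x <-] := covering_surj covu b.
  by exists (orbit_pi x) => //; exact: orbit_map_pi.
move=> b; have [e0 ue0] := covering_surj covu b.
have [U [oU Ub sheetU]] := covering_sheets covu b.
have [|V [s [Ve [oV VU UV cs]]]] := sheetU e0; first by rewrite ue0.
exists U; split=> //.
pose W (g : deck u) := orbit_pi @` (deck_inv g @^-1` V).
have WE g n : W g n <-> exists2 v, V v & orbit_pi (g v) = n.
  split=> [[x /= Vx <-]|[v Vv <-]].
    by exists (deck_inv g x) => //; rewrite deck_invK.
  by exists (g v) => //=; rewrite deck_funK.
(* The sheets are indexed by the sets [W g] themselves and not by [g], because [W (k * g)] and [W g]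
   are equal for [k] in [K]. If two of them meet, freeness of the deck action shows that their
   indices differ by such a [k]. *)
exists {A : set orbit_space | exists g, A = W g}, sval; split.
- move=> [A hA] /=; have [g ->] := hA; apply: orbit_pi_open; apply: open_comp => // x _.
  exact: deck_inv_continuous.
- move=> [A hA] [A' hA'] _ _ /= AA'; apply: eq_exist => /=.
  move: hA hA' AA' => [g ->] [h ->] [n [/WE[v Vv <-] /WE[w Vw]]].
  move=> /esym/orbit_piP[k Kk kgh].
  have vw : v = w.
    rewrite -(proj2 (VU _ Vv)) -(proj2 (VU _ Vw)).
    by rewrite -(deck_over g v) -(deck_over h w) -kgh (deck_over k).
  have hE : (k * g)%g = h.
    by apply: (deck_free covu connMt contrMt (x := w)); rewrite -kgh vw.
  have piE z : orbit_pi (h z) = orbit_pi (g z).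
    by apply/esym/orbit_piP; exists k => //; rewrite -hE.
  by apply/seteqP; split=> n' /WE[z Vz <-]; apply/WE; exists z; rewrite ?piE.
- apply/seteqP; split=> n /=.
    have [x <-] := orbit_pi_surj n; rewrite orbit_map_pi => Ux.
    have [Vs us] := UV _ Ux.
    have [g gs] := deck_transitive covu connMt contrMt us.
    exists (exist _ (W g) (ex_intro _ g erefl)) => //=.
    by apply/WE; exists (s (u x)) => //; rewrite gs.
  move=> [[A hA] _ /=]; have [g ->] := hA => /WE[v Vv <-].
  by rewrite orbit_map_pi deck_over; case: (VU _ Vv).
move=> [A hA] /=; have [g ->] := hA; exists (fun y => orbit_pi (g (s y))); split.
- apply: continuous_subspaceT; exact: orbit_map_continuous.
- rewrite continuous_open_subspace // => y /set_mem Uy.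
  apply: (@continuous_comp _ _ _ s (fun x => orbit_pi (g x))); first exact: cs.
  exact: (continuous_compT (@deck_continuous _ _ _ g) orbit_pi_continuous).
- by move=> n /WE[v Vv <-]; rewrite orbit_map_pi deck_over; case: (VU _ Vv) => ? ->.
- move=> y Uy; have [Vs us] := UV _ Uy.
  by split; [apply/WE; exists (s y)|rewrite orbit_map_pi deck_over].
Qed.

Lemma orbit_space_connected : connected [set: orbit_space].
Proof.
have -> : [set: orbit_space] = orbit_pi @` [set: Mt].
  by apply/seteqP; split=> // n _; have [x <-] := orbit_pi_surj n; exists x.
apply: connected_continuous_connected => //.
exact: (continuous_subspaceT orbit_pi_continuous).
Qed.

(** Normality of [K] lets every deck transformation of [u] descend to the orbit space, and those of
    [u] are already transitive on fibres. *)
Lemma orbit_map_regular : (forall g h : deck u, K g -> K (h * g * h^-1)%g) ->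
  regular_cover orbit_map.
Proof.
move=> nK; split; first by split; [exact: orbit_map_covering|exact: orbit_space_connected].
have push (h : deck u) : exists2 f : orbit_space -> orbit_space, continuous f &
    forall x, f (orbit_pi x) = orbit_pi (h x).
  apply: orbit_factor => [|x g Kg].
    exact: (continuous_compT (@deck_continuous _ _ _ h) orbit_pi_continuous).
  apply/esym/orbit_piP; exists (h * g * h^-1)%g; first exact: nK.
  by rewrite /= deck_funK.
move=> n n'; have [x <-] := orbit_pi_surj n; have [x' <-] := orbit_pi_surj n'.
rewrite !orbit_map_pi => uxx'.
have [h hx] := deck_transitive covu connMt contrMt uxx'.
have [f cf fE] := push h; have [f' cf' f'E] := push h^-1%g.
have fK : cancel f f'.
  by move=> k; have [z <-] := orbit_pi_surj k; rewrite fE f'E /= deck_funK.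
have f'K : cancel f' f.
  by move=> k; have [z <-] := orbit_pi_surj k; rewrite f'E fE /= deck_invK.
have fq k : orbit_map (f k) = orbit_map k.
  by have [z <-] := orbit_pi_surj k; rewrite fE !orbit_map_pi deck_over.
by exists (Deck cf cf' fK f'K fq); rewrite /= fE hx.
Qed.

End OrbitSpace.

Arguments orbit_pi {M Mt u K} sK x.
Arguments orbit_map {M Mt u K} sK n.

Section NormalClosure.
Variables (R : realType) (M Mt : topologicalType) (u : Mt -> M).
Hypotheses (covu : covering_map u) (connMt : connected [set: Mt]).
Hypothesis contrMt : contractible R Mt.

(** Quantifying over all lifts makes this group normal, because [t \o h] is a lift whenever [t] is
    one and [h] is a deck transformation. *)
Definition lift_stabilizer (E : topologicalType) (p : E -> M) : set (deck u) :=
  [set g | forall t, is_lift u p t -> forall x, t (g x) = t x].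

Lemma lift_stabilizer_subgroup (E : topologicalType) (p : E -> M) :
  is_subgroup (lift_stabilizer p).
Proof.
split=> [t lt x //|g h Kg Kh t lt x /=|g Kg t lt x]; first by rewrite Kg // Kh.
by rewrite -(Kg t lt) -[in RHS](deck_invK g x).
Qed.

Lemma lift_stabilizer_normal (E : topologicalType) (p : E -> M) (g h : deck u) :
  lift_stabilizer p g -> lift_stabilizer p (h * g * h^-1)%g.
Proof.
move=> Kg t lt x; rewrite -[in RHS](deck_invK h x).
exact: (Kg (t \o h) (deck_lift h lt)).
Qed.

(** A lift through [p] is constant on [K]-orbits and so descends to the orbit space. For the
    universal property, a regular cover [s] that factors through [E] is dominated by [u] via a lift
    [w], and [orbit_pi] is shown to factor through [w]. *)
Lemma orbit_map_normal_closure (E : topologicalType) (p : E -> M)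
    (K : set (deck u)) (sK : is_subgroup K) :
  lift_property u p -> connected [set: E] -> E -> lift_stabilizer p = K ->
  is_normal_closure p (orbit_map sK).
Proof.
move=> lpE connE y0 KE; have [ex uq op] := lpE.
split.
- apply: (orbit_map_regular covu connMt contrMt) => g h.
  rewrite -KE; exact: lift_stabilizer_normal.
- have [x0 ux0] := covering_surj covu (p y0).
  have [t lt _] := ex x0 y0 (esym ux0).
  have [|r cr rE] := orbit_factor sK lt.1.
    by move=> x g; rewrite -KE => /(_ t lt x).
  exists r => //; apply/funext => n; have [x <-] := orbit_pi_surj n.
  by rewrite /= rE orbit_map_pi lt.2.
move=> P s [[covs connP] regs] [t ct pt].
have lpP := covering_lift_property covu connMt contrMt covs.
have [exP uqP opP] := lpP.
have [x0 _] := contrMt.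
have [z0 sz0] := covering_surj covs (u x0).
have [w lw _] := exP x0 z0 sz0.
have surjw := lift_surj covu connMt contrMt lpP connP lw.
have lift_t v : is_lift u s v -> is_lift u p (t \o v).
  move=> lv; split; first exact: (continuous_compT lv.1 ct).
  by move=> x; rewrite -lv.2 -pt.
have surjt y : exists z, t z = y.
  have [x <-] := lift_surj covu connMt contrMt lpE connE (lift_t _ lw) y.
  by exists (w x).
(* By regularity of [s], each lift [t'] through [p] has the form [t \o h \o w] with [h] a deck
   transformation of [s]. Hence points identified by [w] are identified by all such lifts. *)
have wK x x' : w x = w x' -> orbit_pi sK x = orbit_pi sK x'.
  move=> wxx'.
  have [g gx] : exists g : deck u, g x = x'.
    by apply: (deck_transitive covu connMt contrMt); rewrite -(lw.2 x) wxx' lw.2.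
  apply/orbit_piP; exists g => //; rewrite -KE => t' lt'.
  suff t'x : t' x = t' (g x).
    have tg : is_lift u p (t' \o g) by exact: deck_lift.
    exact: (uq _ _ x tg lt' (esym t'x)).
  have [z tz] := surjt (t' x).
  have [h hz] : exists h : deck s, h (w x) = z.
    by apply: regs; rewrite lw.2 -pt /= tz lt'.2.
  have lhw : is_lift u s (h \o w).
    split; first exact: (continuous_compT lw.1 (@deck_continuous _ _ _ h)).
    by move=> a /=; rewrite deck_over lw.2.
  have E1 : t \o (h \o w) =1 t'.
    by apply: (uq _ _ x (lift_t _ lhw) lt'); rewrite /= hz.
  by rewrite gx -(E1 x) -(E1 x') /= wxx'.
(* The section [w'] of [w] is merely set-theoretic; its composite with [orbit_pi] is continuous
   because [w] is open. *)
have [w' w'K] := choice surjw.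
exists (orbit_pi sK \o w').
  apply/continuousP => O oO.
  have -> : (orbit_pi sK \o w') @^-1` O = w @` (orbit_pi sK @^-1` O).
    apply/seteqP; split=> [z /= Oz|_ [x /= Ox <-]]; first by exists (w' z).
    by rewrite (wK _ x).
  apply: opP => //; apply: open_comp => // x _; exact: orbit_pi_continuous.
by apply/funext => z /=; rewrite orbit_map_pi -lw.2 w'K.
Qed.

Lemma same_normal_closure_of_stabilizers (E1 E2 : topologicalType)
    (p1 : E1 -> M) (p2 : E2 -> M) :
  lift_property u p1 -> connected [set: E1] -> E1 ->
  lift_property u p2 -> connected [set: E2] -> E2 ->
  lift_stabilizer p1 = lift_stabilizer p2 -> same_normal_closure p1 p2.
Proof.
move=> lp1 c1 y1 lp2 c2 y2 K12.
pose sK := lift_stabilizer_subgroup p1.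
by exists (orbit_space sK), (orbit_map sK); split; exact: orbit_map_normal_closure.
Qed.

End NormalClosure.

(** * Fundamental groups of covers, and lift stabilizers as cores *)

Lemma pi1_map_injective (R : realType) (X Y : topologicalType)
    (f : continuousType X Y) (x : X) (y : Y) (e : f x = y) :
  covering_map f -> injective (@pi1_map R _ _ f _ _ e).
Proof.
move=> cov; elim/pi1_ind=> a; elim/pi1_ind=> b; rewrite !pi1_mapE.
move=> /pi1_classP[H [cH Ha Hb H0 H1]]; apply/pi1_classP.
have [|||||||G [cG Ga Gb G0 G1]] := @path_homotopy_lifting R _ _ f H a b cov cH.
- exact: cts_fun.
- exact: cts_fun.
- exact: Ha.
- exact: Hb.
- by move=> s; rewrite H0 path_zero.
- by move=> s; rewrite H1 path_one.
- by rewrite !path_zero.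
by exists G; split=> // s; rewrite ?G0 ?G1 ?path_zero ?path_one.
Qed.

Lemma pi1_mulgE (R : realType) (X : topologicalType) (x : X) (a b : loop R x) :
  (pi1_class a * pi1_class b)%g = pi1_class (path_cat a b).
Proof. exact: pi1_mulE. Qed.

Lemma pi1_invgE (R : realType) (X : topologicalType) (x : X) (a : loop R x) :
  (pi1_class a)^-1%g = pi1_class (path_rev a).
Proof. exact: pi1_invE. Qed.

Section StabilizerMonodromy.
Variables (R : realType) (M Mt : topologicalType) (u : Mt -> M).
Hypotheses (covu : covering_map u) (connMt : connected [set: Mt]).
Hypothesis contrMt : contractible R Mt.
Variables (E E' : topologicalType) (p : continuousType E M) (p' : continuousType E' E).
Hypotheses (covp : covering_map p) (covp' : covering_map p').
Hypothesis connE' : connected [set: E'].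
Variables (m : M) (y : E) (y' : E') (e : p y = m) (e' : p' y' = y).
Variables (x0 : Mt) (ux0 : u x0 = m).

Section DeckLoop.
Variables (g : deck u) (a : {path I01 R from x0 to g x0}).

Lemma deck_loop_continuous : continuous (fun s => u (a s)).
Proof. exact: (continuous_compT (@cts_fun _ _ a) (covering_continuous covu)). Qed.

Lemma deck_loop0 : u (a zero) = m. Proof. by rewrite path_zero. Qed.
Lemma deck_loop1 : u (a one) = m. Proof. by rewrite path_one deck_over. Qed.

(** Its class is the element of the fundamental group of [M] that corresponds to the deck
    transformation [g]. *)
Definition deck_loop : loop R m := mk_path deck_loop_continuous deck_loop0 deck_loop1.

Lemma comp_lift_property : lift_property u (p \o p').
Proof.
apply: (lift_property_comp connMt contrMt) => //; first exact: cts_fun.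
exact: (covering_lift_property covu connMt contrMt).
Qed.

(** Lift the loop [l] to a path [d] from [y'], and take the lift [t] of [u] with [t x0] at the end
    of [d]. As [g] fixes [t], the path [t \o a] closes up, and going along [d], this loop and [d]
    backwards gives a loop at [y'] over the conjugate. *)
Lemma stabilizer_conj :
  lift_stabilizer (p \o p') g -> forall x : pi1 R m,
  exists b : pi1 R y', (x * pi1_class deck_loop * x^-1)%g = pi1_map e (pi1_map e' b).
Proof.
move=> Kg; elim/pi1_ind=> l; have [ex _ _] := comp_lift_property.
have [||l1 [cl1 pl1 l10]] := @path_lifting R _ _ p l y covp.
- exact: cts_fun.
- by rewrite path_zero.
have [|l2 [cl2 pl2 l20]] := @path_lifting R _ _ p' l1 y' covp' cl1.
  by rewrite l10.
have pl2m : (p \o p') (l2 one) = u x0 by rewrite /= pl2 pl1 path_one.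
have [t lt tx0] := ex _ _ pl2m.
have cta : continuous (fun s => t (a s)).
  exact: (continuous_compT (@cts_fun _ _ a) lt.1).
have ta0 : t (a zero) = l2 one by rewrite path_zero.
have ta1 : t (a one) = l2 one by rewrite path_one Kg.
pose d : {path I01 R from y' to l2 one} := mk_path cl2 l20 erefl.
pose v : {path I01 R from l2 one to l2 one} := mk_path cta ta0 ta1.
exists (pi1_class (path_cat (path_cat d v) (path_rev d))).
rewrite pi1_invgE !pi1_mulgE !pi1_mapE; congr pi1_class; apply/path_eqP => s.
have dE r : l r = p (p' (l2 r)) by rewrite -pl1 -pl2.
have vE r : u (a r) = p (p' (t (a r))) by rewrite -(lt.2 (a r)).
rewrite /= /mk_path /path_cat_fun /path_rev_fun.
by do 2?[case: ifP => _]; rewrite ?dE ?vE.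
Qed.

(** By uniqueness it suffices that [t (g x0) = t x0]. Both are ends of paths in [E'] starting at
    [y'] whose projections to [M] are homotopic. *)
Lemma conj_stabilizer :
  (forall x : pi1 R m, exists b : pi1 R y',
     (x * pi1_class deck_loop * x^-1)%g = pi1_map e (pi1_map e' b)) ->
  lift_stabilizer (p \o p') g.
Proof.
move=> conj t lt; have lp := comp_lift_property; have [_ uq _] := lp.
apply: (uq (t \o g) t x0) => //; first exact: deck_lift.
have [x1 tx1] := lift_surj covu connMt contrMt lp connE' lt y'.
have [d0 [cd0 d00 d01]] := contractible_path contrMt x1 x0.
have ctd : continuous (fun s => t (d0 s)) by exact: (continuous_compT cd0 lt.1).
have td0 : t (d0 zero) = y' by rewrite d00.
have td1 : t (d0 one) = t x0 by rewrite d01.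
pose d : {path I01 R from y' to t x0} := mk_path ctd td0 td1.
have cta : continuous (fun s => t (a s)).
  exact: (continuous_compT (@cts_fun _ _ a) lt.1).
have ta0 : t (a zero) = t x0 by rewrite path_zero.
have ta1 : t (a one) = t (g x0) by rewrite path_one.
pose v : {path I01 R from t x0 to t (g x0)} := mk_path cta ta0 ta1.
have cl : continuous (fun s => p (p' (d s))).
  apply: (continuous_compT _ (@cts_fun _ _ p)).
  by apply: (continuous_compT _ (@cts_fun _ _ p')); exact: cts_fun.
have l0 : p (p' (d zero)) = m by rewrite path_zero e' e.
have l1 : p (p' (d one)) = m by rewrite path_one -ux0 -[LHS]/((p \o p') (t x0)) lt.2.
pose l : loop R m := mk_path cl l0 l1.
have [b] := conj (pi1_class l); elim/pi1_ind: b => b.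
rewrite !pi1_mapE => /(congr1 (fun z => z * pi1_class l)%g).
(* Multiplying by the class of [l] removes the inverse: [l] followed by [deck_loop] is homotopic to
   the image of [b] followed by [l]. The lifts from [y'] end at [t (g x0)] and [t x0]; the homotopy
   is lifted first through [p], then through [p']. *)
rewrite mulgVK !pi1_mulgE => /pi1_classP[H [cH Ha Hb H0 H1]].
have vE r : deck_loop r = p (p' (v r)) by rewrite -[RHS]/((p \o p') (t (a r))) lt.2.
have catE r : path_cat l deck_loop r = p (p' (path_cat d v r)).
  rewrite /= /mk_path /path_cat_fun; case: ifP => _ //.
  by rewrite -[RHS]/(p (p' (v _))) -vE.
have catE' r : path_cat (map_loop e (map_loop e' b)) l r = p (p' (path_cat b d r)).
  by rewrite /= /mk_path /path_cat_fun; case: ifP.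
have cp'cat (z z' z'' : E') (c : {path I01 R from z to z'}) (c' : {path I01 R from z' to z''}) :
    continuous (fun r => p' (path_cat c c' r)).
  by apply: (continuous_compT _ (@cts_fun _ _ p')); exact: cts_fun.
have [|||||G [cG Ga Gb G0 G1]] := @path_homotopy_lifting R _ _ p H
    (fun r => p' (path_cat d v r)) (fun r => p' (path_cat b d r)) covp cH (cp'cat _ _ _ _ _)
    (cp'cat _ _ _ _ _).
- by move=> r; rewrite Ha catE.
- by move=> r; rewrite Hb catE'.
- by move=> r; rewrite H0 path_zero e' e.
- move=> r; rewrite H1 path_one.
  by rewrite -[RHS]/((p \o p') (t (g x0))) lt.2 deck_over ux0.
- by rewrite !path_zero.
have [|||||||G' [cG' Ga' Gb' G0' G1']] := @path_homotopy_lifting R _ _ p' G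
    (path_cat d v) (path_cat b d) covp' cG.
- exact: cts_fun.
- exact: cts_fun.
- exact: Ga.
- exact: Gb.
- exact: G0.
- exact: G1.
- by rewrite !path_zero.
by have := G1' one; rewrite Gb' !path_one.
Qed.

Lemma lift_stabilizerP (U : set (H1Z (pi1 R y))) :
  pi1_image R e' = @ab_class (pi1 R y) @^-1` U ->
  lift_stabilizer (p \o p') g <->
  forall x : pi1 R m, exists2 k : pi1 R y,
    (x * pi1_class deck_loop * x^-1)%g = pi1_map e k & U (ab_class k).
Proof.
move=> imU; split=> [Kg x|conj].
  have [b bE] := stabilizer_conj Kg x; exists (pi1_map e' b) => //.
  suff : (@ab_class (pi1 R y) @^-1` U) (pi1_map e' b) by [].
  by rewrite -imU; exists b.
apply: conj_stabilizer => x; have [k kE Uk] := conj x.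
have [b _ bE] : pi1_image R e' k by rewrite imU.
by exists b; rewrite kE -bE.
Qed.

End DeckLoop.
End StabilizerMonodromy.

(** * Shapiro's isomorphism in degree one *)

Section FinsuppExtension.
Variables (K : choiceType) (A B : zmodType) (F : K -> {additive A -> B}).

(** The universal property of the direct sum, used to define chain maps and homotopies by their
    values on generators. *)
Definition finsupp_ext (c : finsupp K A) : B := \sum_(k \in [set: K]) F k (c k).

Lemma finsupp_ext_is_zmod : zmod_morphism finsupp_ext.
Proof. by move=> c c'; exact: (fsum_additive F). Qed.

HB.instance Definition _ := GRing.isZmodMorphism.Build _ _
  finsupp_ext finsupp_ext_is_zmod.

Lemma finsupp_ext_single k a : finsupp_ext (single k a) = F k a.
Proof. exact: (fsum_single F). Qed.

End FinsuppExtension.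

Lemma eq_on_single2 (K L : choiceType) (A B : zmodType)
    (f g : {additive finsupp K (finsupp L A) -> B}) :
  (forall k l a, f (single k (single l a)) = g (single k (single l a))) -> f =1 g.
Proof.
move=> fg; apply: eq_on_single => k.
apply: (@eq_on_single _ _ _ (f \o single k : {additive _ -> _})
  (g \o single k : {additive _ -> _})) => l a.
exact: fg.
Qed.

Lemma finsupp_int_ind (K : choiceType) (P : finsupp K int -> Prop) :
  P 0 -> (forall a b, P a -> P b -> P (a - b)) -> (forall k, P (single k 1)) ->
  forall a, P a.
Proof.
move=> P0 PB P1.
have PN a : P a -> P (- a) by move=> Pa; rewrite -sub0r; exact: PB.
have PD a b : P a -> P b -> P (a + b).
  by move=> Pa Pb; rewrite -[b]opprK; apply: PB => //; exact: PN.
have Pn k (n : nat) : P (single k n%:Z).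
  elim: n => [|n IH]; first by rewrite raddf0.
  by rewrite intS raddfD; apply: PD; [exact: P1|exact: IH].
have Pz k (n : int) : P (single k n).
  by case: n => n; [exact: Pn|rewrite NegzE raddfN; apply: PN; exact: Pn].
move=> a; have /finite_fsetP [X hX] := fcoef_finite a.
rewrite (finsupp_sumE a) (@fsumE _ _ _ (@single K int) a X) ?hX // => [|k].
  by apply: big_ind.
by rewrite raddf0.
Qed.

Lemma single1_inj (K : choiceType) (k l : K) : single k (1 : int) = single l 1 -> k = l.
Proof.
move=> /finsuppP/(_ k); rewrite /fcoef /= eqxx.
by case: (k =P l).
Qed.

Section H1Additive.
Variables (G : groupType) (A : gmodule G).

Lemma H1_class0 : H1_class (0 : bar_cycle A) = 0.
Proof. by rewrite /H1_class raddf0. Qed.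

Lemma H1_classB (z z' : bar_cycle A) : H1_class (z - z') = H1_class z - H1_class z'.
Proof. by rewrite /H1_class raddfB. Qed.

Lemma H1_ind (P : H1 A -> Prop) : (forall z, P (H1_class z)) -> forall c, P c.
Proof. by move=> Pz c; rewrite -[c]reprK; exact: Pz. Qed.

End H1Additive.

Lemma H1_mapB (G G' : groupType) (A : gmodule G) (A' : gmodule G')
  (f : coefHom A A') : {morph H1_map f : c c' / c - c'}.
Proof.
elim/H1_ind=> z; elim/H1_ind=> z'.
rewrite -H1_classB !H1_mapE -H1_classB; congr H1_class; apply: val_inj.
exact: bar_map1_is_zmod.
Qed.

Lemma to_coset_eq_mem (G : groupType) (H : set G) (a b : G) : is_subgroup H ->
  to_coset H a = to_coset H b -> H (a^-1 * b)%g.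
Proof.
move=> [H1 HM HV] /(congr1 val) /= /seteqP[_ /(_ b)].
case=> [|h Hh <-]; first by exists 1%g => //; rewrite mulg1.
by rewrite mulKg.
Qed.

Lemma to_coset_surj (G : groupType) (H : set G) (x : coset_type H) :
  exists g, to_coset H g = x.
Proof. by have /set_mem[g _ gx] := valP x; exists g; apply: val_inj. Qed.

Section ShapiroIso.
Variables (G' G : groupType) (f : {multiplicative G' -> G}).
Hypothesis finj : injective f.
Local Notation H := (range f).
Local Notation A := (perm_gmodule H).
Local Notation Z := (trivial_gmodule G' int).

(** The normalization at the trivial coset makes [unshapiro1] a strict left inverse of Shapiro's map
    on chains. *)
Lemma coset_section : exists s : coset_type H -> G,
  (forall x, to_coset H (s x) = x) /\ s (to_coset H 1%g) = 1%g.
Proof.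
have [s0 s0K] := choice (@to_coset_surj G H).
exists (fun x => if x == to_coset H 1%g then 1%g else s0 x); rewrite eqxx.
by split=> // x; case: eqP.
Qed.

Definition csec : coset_type H -> G := projT1 (cid coset_section).

Lemma csecK x : to_coset H (csec x) = x.
Proof. by rewrite /csec; case: cid => s []. Qed.

Lemma csec1 : csec (to_coset H 1%g) = 1%g.
Proof. by rewrite /csec; case: cid => s []. Qed.

Lemma coset_cocycle : exists r : coset_type H * G -> G', forall xg,
  f (r xg) = ((csec xg.1)^-1 * xg.2 * csec (coset_act xg.2^-1%g xg.1))%g.
Proof.
suff ex (xg : coset_type H * G) : exists k,
    f k = ((csec xg.1)^-1 * xg.2 * csec (coset_act xg.2^-1%g xg.1))%g.
  by have [r rE] := choice ex; exists r.
case: xg => x g /=; suff [k _ <-] : H ((csec x)^-1 * g * csec (coset_act g^-1%g x))%g by exists k.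
rewrite -mulgA; apply: to_coset_eq_mem; first exact: range_subgroup.
by rewrite -coset_act_to !csecK -coset_actM mulgV coset_act1.
Qed.

Definition cocyc (x : coset_type H) (g : G) : G' := projT1 (cid coset_cocycle) (x, g).

Lemma cocycE x g :
  f (cocyc x g) = ((csec x)^-1 * g * csec (coset_act g^-1%g x))%g.
Proof. by rewrite /cocyc; case: cid => r /= ->. Qed.

(** The values of the section at the intermediate coset cancel. This cocycle identity is what makes
    [unshapiro1] compatible with [bar_d2]. *)
Lemma cocycM x g h :
  cocyc x (g * h)%g = (cocyc x g * cocyc (coset_act g^-1%g x) h)%g.
Proof.
apply: finj; rewrite gmulfM !cocycE invgM coset_actM !mulgA.
by rewrite mulgK.
Qed.

Lemma cocyc1 g : cocyc (to_coset H 1%g) (f g) = g.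
Proof.
apply: finj; rewrite cocycE coset_act_to mulg1 to_coset_eq1 ?csec1.
- by rewrite invg1 mul1g mulg1.
- exact: range_subgroup.
- by case: (range_subgroup f) => _ _; apply; exists g.
Qed.

(* The inverse of Shapiro's isomorphism, x[g] |-> [s(x)^-1 g s(g^-1 x)] for the
   section s = csec of the quotient map; unshapiro2 is its degree two part. *)
Definition unshapiro1 : finsupp G A -> finsupp G' Z :=
  finsupp_ext (fun g => finsupp_ext
    (fun x => single (cocyc x g) : {additive int -> finsupp G' Z})).
HB.instance Definition _ := GRing.Additive.on unshapiro1.

Lemma unshapiro1_single g x n :
  unshapiro1 (single g (single x n)) = single (cocyc x g) n.
Proof. rewrite /unshapiro1 finsupp_ext_single; exact: finsupp_ext_single. Qed.

Definition unshapiro2 : finsupp (G * G)%type A -> finsupp (G' * G')%type Z :=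
  finsupp_ext (fun g => finsupp_ext
    (fun x => single (cocyc x g.1, cocyc (coset_act g.1^-1%g x) g.2) :
       {additive int -> finsupp (G' * G')%type Z})).
HB.instance Definition _ := GRing.Additive.on unshapiro2.

Lemma unshapiro2_single g x n : unshapiro2 (single g (single x n)) =
  single (cocyc x g.1, cocyc (coset_act g.1^-1%g x) g.2) n.
Proof. rewrite /unshapiro2 finsupp_ext_single; exact: finsupp_ext_single. Qed.

Lemma unshapiro1_d2 c : unshapiro1 (bar_d2 c) = bar_d2 (unshapiro2 c).
Proof.
move: c; apply: (@eq_on_single2 _ _ _ _
  (unshapiro1 \o @bar_d2 _ A : {additive _ -> _})
  (@bar_d2 _ Z \o unshapiro2 : {additive _ -> _})) => g x n /=.
rewrite unshapiro2_single !bar_d2_single raddfD raddfB /=.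
by rewrite perm_act_single !unshapiro1_single cocycM.
Qed.

Lemma unshapiro1_shapiro c : unshapiro1 (bar_map1 (shapiro_coef f) c) = c.
Proof.
move: c; apply: (@eq_on_single _ _ _
  (unshapiro1 \o bar_map1 (shapiro_coef f) : {additive _ -> _}) idfun) => g n /=.
by rewrite bar_map1_single unshapiro1_single /= cocyc1.
Qed.

Lemma shapiro_inj : injective (shapiro f).
Proof.
elim/H1_ind=> z; elim/H1_ind=> z'.
rewrite /shapiro !H1_mapE => /H1_class_eq[c hc]; apply/H1_class_eq.
by exists (unshapiro2 c); rewrite -unshapiro1_d2 hc raddfB /= !unshapiro1_shapiro.
Qed.

Definition prism0 : A -> finsupp G A :=
  finsupp_ext (fun x => single (csec x) \o single x : {additive int -> finsupp G A}).
HB.instance Definition _ := GRing.Additive.on prism0.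

(** The two symbols come from the two factorizations [csec x * f (cocyc x g)] and
    [g * csec (coset_act g^-1 x)] of one element of [G], so their middle faces cancel. *)
Definition prism1 : finsupp G A -> finsupp (G * G)%type A :=
  finsupp_ext (fun g => finsupp_ext (fun x =>
    (single (csec x, f (cocyc x g)) \o single x)
    \- (single (g, csec (coset_act g^-1%g x)) \o single x) :
    {additive int -> finsupp (G * G)%type A})).
HB.instance Definition _ := GRing.Additive.on prism1.

Lemma prism0_single x n : prism0 (single x n) = single (csec x) (single x n).
Proof. exact: finsupp_ext_single. Qed.

Lemma prism1_single g x n : prism1 (single g (single x n)) =
  single (csec x, f (cocyc x g)) (single x n)
  - single (g, csec (coset_act g^-1%g x)) (single x n).
Proof. rewrite /prism1 finsupp_ext_single; exact: finsupp_ext_single. Qed.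

(* prism is a chain homotopy from the identity to shapiro \o unshapiro. *)
Lemma prismE c : bar_d2 (prism1 c) + prism0 (bar_d1 c) =
  bar_map1 (shapiro_coef f) (unshapiro1 c) - c.
Proof.
move: c; apply: (@eq_on_single2 _ _ _ _
  ((@bar_d2 _ A \o prism1) \+ (prism0 \o @bar_d1 _ A) : {additive _ -> _})
  ((bar_map1 (shapiro_coef f) \o unshapiro1) \- idfun : {additive _ -> _})) => g x n /=.
rewrite unshapiro1_single bar_map1_single prism1_single raddfB /= !bar_d2_single.
rewrite bar_d1_single raddfB /= !perm_act_single !prism0_single.
have -> : coset_act (csec x)^-1%g x = to_coset H 1%g.
  by rewrite -[in X in coset_act _ X](csecK x) coset_act_to mulVg.
have -> : (csec x * f (cocyc x g) = g * csec (coset_act g^-1%g x))%g.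
  by rewrite cocycE !mulgA mulgV mul1g.
set a := single _ _; set b := single _ _; set c := single _ _.
set d := single _ _; set e := single _ _.
(* Of the eight terms, the two middle faces cancel, and the terms at [csec x] and at
   [csec (coset_act g^-1 x)] cancel against [prism0]. *)
rewrite !opprD opprK [LHS](AC (3*3*2) (1*6*(2*5)*(3*8)*(4*7))) /=.
by rewrite addNr addrN addNr !addr0.
Qed.

Lemma trivial_cycle (c : finsupp G' Z) : c \in @bar_cycle_pred _ Z.
Proof.
apply/eqP; move: c; apply: (@eq_on_single _ _ _ (@bar_d1 _ Z) \0) => g n.
by rewrite /= [LHS](@bar_d1_single _ Z) subrr.
Qed.

Lemma shapiro_surj c : exists c', shapiro f c' = c.
Proof.
elim/H1_ind: c => z.
exists (@H1_class _ Z (Sub (unshapiro1 (\val z)) (trivial_cycle _))).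
rewrite /shapiro H1_mapE; apply/H1_class_eq; exists (prism1 (\val z)).
by rewrite /= -prismE (eqP (valP z)) raddf0 addr0.
Qed.

End ShapiroIso.

(** * Comparison of cores *)

Definition mk_bar_cycle (G : groupType) (A : gmodule G) (c : finsupp G A)
  (hc : c \in @bar_cycle_pred G A) : bar_cycle A := Sub c hc.

Section CoefficientIso.
Variables (G : groupType) (A B : gmodule G) (psi : gmodHom A B).
Hypothesis psi_bij : bijective psi.

Lemma gmodHom_inverse : exists2 phi : gmodHom B A, cancel psi phi & cancel phi psi.
Proof.
have [h hK Kh] := psi_bij.
have hB : zmod_morphism h by move=> a b; apply: (bij_inj psi_bij); rewrite raddfB !Kh.
have hact g b : h (gact g b) = gact g (h b).
  by apply: (bij_inj psi_bij); rewrite gmodHom_act !Kh.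
pose ha : {additive B -> A} := HB.pack h (GRing.isZmodMorphism.Build _ _ h hB).
by exists (@GModHom G B A ha hact).
Qed.

Lemma H1_map_inj : injective (H1_map (gmodHom_coef psi)).
Proof.
have [phi psiK _] := gmodHom_inverse.
suff : cancel (H1_map (gmodHom_coef psi)) (H1_map (gmodHom_coef phi)).
  exact: can_inj.
elim/H1_ind=> z; rewrite !H1_mapE; congr H1_class; apply: val_inj => /=.
move: (val z); apply: (@eq_on_single _ _ _ (bar_map1 (gmodHom_coef phi) \o
  bar_map1 (gmodHom_coef psi) : {additive _ -> _}) idfun) => g a /=.
by rewrite !bar_map1_single /= psiK.
Qed.

End CoefficientIso.

Section CoreClass.
Variables (G' G : groupType) (f : {multiplicative G' -> G}).
Hypothesis finj : injective f.
Variable U : set (H1Z G').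
Hypotheses (U0 : U 0) (UB : forall a b, U a -> U b -> U (a - b)).
Local Notation H := (range f).
Local Notation A := (perm_gmodule H).

(** This condition mentions neither conjugates of [g] nor the subgroup beyond its permutation
    module, so it can be transported along a module isomorphism. *)
Definition shapiro_class_in (g : G) (a : A) : Prop :=
  exists z : bar_cycle A,
    \val z = single g a /\ exists2 c, U c & shapiro f c = H1_class z.

Lemma fixed_cycle (g : G) (a : A) :
  gact g^-1%g a = a <-> single g a \in @bar_cycle_pred G A.
Proof.
split=> [ga|/eqP]; last by rewrite bar_d1_single => /eqP; rewrite subr_eq0 => /eqP.
by apply/eqP; rewrite bar_d1_single ga subrr.
Qed.

(* x[g] and 1[x^-1 g x] are homologous: they differ by the boundary of
   x[x | x^-1 g x] - x[g | x]. *)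
Lemma shapiro_conj (g x : G) (k : G') (z : bar_cycle A) :
  (x^-1 * g * x)%g = f k -> \val z = single g (single (to_coset H x) 1 : A) ->
  shapiro f (ab_class k) = H1_class z.
Proof.
move=> gk zE; have := valP z; rewrite zE => /fixed_cycle gx.
rewrite /shapiro /ab_class H1_mapE; apply/H1_class_eq.
pose X : A := single (to_coset H x) 1.
exists (single (x, (x^-1 * g * x)%g) X - single (g, x) X).
rewrite raddfB /= !bar_d2_single /= zE bar_map1_single /= -gk -/X.
rewrite -[perm_act g^-1%g X]/(gact g^-1%g X) gx perm_act_single coset_act_to mulVg !mulgA.
rewrite mulgV mul1g.
set a := single _ _; set b := single _ _; set c := single _ _; set d := single _ _.
rewrite !opprD opprK [LHS](AC (3*3) (1*6*(2*5)*(3*4))) /=.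
by rewrite addNr addrN !addr0.
Qed.

(** From left to right, the condition is additive in [a], so it is enough to treat a single coset,
    where [shapiro_conj] applies. Conversely, if a coset times [[g]] is a cycle then [g] fixes that
    coset, which puts the conjugate of [g] in the range of [f]; injectivity of Shapiro's map then
    identifies its class. *)
Lemma shapiro_class_inP (g : G) :
  (forall x, exists2 k, (x * g * x^-1)%g = f k & U (ab_class k)) <->
  (forall a, shapiro_class_in g a).
Proof.
split=> [core|cls x].
  apply: finsupp_int_ind => [|a b [z [zE [c Uc cz]]] [z' [z'E [c' Uc' cz']]]|x].
  - exists 0; split; first by rewrite !raddf0.
    exists 0 => //; rewrite H1_class0.
    by have := H1_mapB (shapiro_coef f) 0 0; rewrite !subrr.
  - exists (z - z'); split; first by rewrite !raddfB /= zE z'E.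
    by exists (c - c'); [exact: UB|rewrite H1_classB -cz -cz' /shapiro H1_mapB].
  - have [x0 <-] := to_coset_surj x.
    have [k gk Uk] := core x0^-1%g; rewrite invgK in gk.
    have fx : single g (single (to_coset H x0) 1 : A) \in @bar_cycle_pred G A.
      apply/fixed_cycle; rewrite [LHS]perm_act_single coset_act_to; congr single.
      have -> : (g^-1 * x0 = x0 * (f k)^-1)%g.
        by rewrite -gk !invgM invgK !mulgA mulgV mul1g.
      rewrite -coset_act_to -{2}[x0]mulg1 -coset_act_to; congr coset_act.
      have [_ _ HV] := range_subgroup f.
      by apply: to_coset_eq1; [exact: range_subgroup|apply: HV; exists k].
    exists (mk_bar_cycle fx); split=> //; exists (ab_class k) => //.
    exact: (@shapiro_conj g x0 k).
(* The coset of the inverse is used because the stabilizer of the coset of [x^-1] is the conjugate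
   of [H] by [x^-1]. *)
have [z [zE [c Uc cz]]] := cls (single (to_coset H x^-1%g) 1).
have := valP z; rewrite zE => /fixed_cycle.
rewrite [LHS]perm_act_single coset_act_to => /single1_inj/esym.
move=> /(to_coset_eq_mem (range_subgroup f)); rewrite invgK.
case: (range_subgroup f) => _ _ HV /HV[k _ fk].
have gk : (x * g * x^-1)%g = f k by rewrite fk !invgM !invgK.
exists k => //; suff -> : ab_class k = c by [].
by apply: (shapiro_inj finj); rewrite cz; apply: shapiro_conj zE; rewrite invgK.
Qed.

End CoreClass.

Arguments shapiro_class_in {G' G} f U g a.

Section CoreComparison.
Variables (G1 G2 G : groupType) (f1 : {multiplicative G1 -> G}).
Variable f2 : {multiplicative G2 -> G}.
Hypotheses (inj1 : injective f1) (inj2 : injective f2).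
Variable psi : gmodHom (perm_gmodule (range f1)) (perm_gmodule (range f2)).
Hypothesis psi_bij : bijective psi.
Variables (U1 : set (H1Z G1)) (U2 : set (H1Z G2)).
Hypothesis U12 : (fun c => 'pinv_(fun=> 0) [set: H1Z G2] (shapiro f2)
  (H1_map (gmodHom_coef psi) (shapiro f1 c))) @` U1 = U2.

Lemma shapiro_pinvK c : shapiro f2 ('pinv_(fun=> 0) [set: H1Z G2] (shapiro f2) c) = c.
Proof.
by apply: pinvK; apply/mem_set; have [c' <-] := shapiro_surj c; exists c'.
Qed.

(** The chain map induced by [psi] sends [a[g]] to [psi(a)[g]]. Surjectivity of [psi] gives one
    direction; the other uses its injectivity, on the module and on homology. *)
Lemma shapiro_class_in_psi (g : G) :
  (forall a, shapiro_class_in f1 U1 g a) <-> (forall b, shapiro_class_in f2 U2 g b).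
Proof.
split=> cls.
  have [phi _ phiK] := gmodHom_inverse psi_bij.
  move=> b; have [z [zE [c Uc cz]]] := cls (phi b).
  exists (mk_bar_cycle (bar_map1_cycle (gmodHom_coef psi) z)); split.
    by rewrite /= zE bar_map1_single /= phiK.
  exists ('pinv_(fun=> 0) [set: H1Z G2] (shapiro f2)
     (H1_map (gmodHom_coef psi) (shapiro f1 c))); first by rewrite -U12; exists c.
  by rewrite shapiro_pinvK cz H1_mapE.
move=> a; have [z [zE [c Uc cz]]] := cls (psi a).
have ca : single g a \in @bar_cycle_pred G (perm_gmodule (range f1)).
  apply/fixed_cycle; apply: (bij_inj psi_bij); rewrite gmodHom_act.
  by apply/fixed_cycle; rewrite -zE; exact: valP.
exists (mk_bar_cycle ca); split=> //.
move: Uc; rewrite -U12 => -[c1 Uc1 c1E]; exists c1 => //.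
apply: (H1_map_inj psi_bij); rewrite -[LHS]shapiro_pinvK c1E cz H1_mapE.
by congr H1_class; apply: val_inj; rewrite /= zE bar_map1_single.
Qed.

Lemma core_comparison (g : G) :
  U1 0 -> (forall a b, U1 a -> U1 b -> U1 (a - b)) ->
  U2 0 -> (forall a b, U2 a -> U2 b -> U2 (a - b)) ->
  (forall x, exists2 k, (x * g * x^-1)%g = f1 k & U1 (ab_class k)) <->
  (forall x, exists2 k, (x * g * x^-1)%g = f2 k & U2 (ab_class k)).
Proof.
move=> U10 U1B U20 U2B.
apply: iff_trans (shapiro_class_inP inj1 U10 U1B g) _.
apply: iff_trans (shapiro_class_in_psi g) _.
exact: iff_sym (shapiro_class_inP inj2 U20 U2B g).
Qed.

End CoreComparison.

(** * Equality of the normal closures *)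

Theorem theorem1p8 (R : realType) (n d d' : nat)
  (M Mt M1 M2 M1' M2' : topologicalType)
  (u : Mt -> M)
  (p1 : continuousType M1 M) (p2 : continuousType M2 M)
  (p1' : continuousType M1' M1) (p2' : continuousType M2' M2)
  (m : M) (m1 : M1) (m2 : M2) (m1' : M1') (m2' : M2')
  (e1 : p1 m1 = m) (e2 : p2 m2 = m) (e1' : p1' m1' = m1) (e2' : p2' m2' = m2)
  (psi : gmodHom (perm_gmodule (pi1_image R e1))
                 (perm_gmodule (pi1_image R e2))) :
  is_manifold R n M -> connected [set: M] ->
  universal_cover R u -> contractible R Mt ->
  connected_cover p1 -> connected_cover p2 ->
  cover_degree p1 d -> cover_degree p2 d ->
  integrally_equivalent p1 p2 ->
  normalized_iso psi ->
  connected_cover p1' -> connected_cover p2' ->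
  corresponding_covers e1' e2' psi d' ->
  coprime d d' ->
  same_normal_closure (p1 \o p1') (p2 \o p2').
Proof.
move=> _ _ [[covu connMt] _] contrMt [cov1 _] [cov2 _] _ _ _ [psi_bij _ _].
move=> [cov1' conn1'] [cov2' conn2'].
move=> [U1 [U2 [[U10 U1B _] [U20 U2B _] U12 im1 im2]]] _.
have [x0 ux0] := covering_surj covu m.
apply: (same_normal_closure_of_stabilizers covu connMt contrMt) => //.
- exact: (comp_lift_property covu connMt contrMt cov1 cov1').
- exact: (comp_lift_property covu connMt contrMt cov2 cov2').
suff K12 (g : deck u) : lift_stabilizer (p1 \o p1') g <-> lift_stabilizer (p2 \o p2') g.
  by apply/seteqP; split=> g /K12.
(* One path from [x0] to [g x0] serves both towers, so the same element of the fundamental group of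
   [M] is tested against the two cores. *)
have [a [ca a0 a1]] := contractible_path contrMt x0 (g x0).
pose ag : {path I01 R from x0 to g x0} := mk_path ca a0 a1.
apply: iff_trans (lift_stabilizerP covu connMt contrMt cov1 cov1' conn1' e1 ux0 ag im1) _.
apply: iff_trans (iff_sym (lift_stabilizerP covu connMt contrMt cov2 cov2' conn2' e2 ux0 ag im2)).
by apply: (core_comparison (pi1_map_injective cov1) (pi1_map_injective cov2) psi_bij U12).
Qed.
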